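(* Let $k$ be an algebraically closed field, $n\ge 2$, let $B\subseteq \mathrm{GL}_n(k)$ be the Borel subgroup of invertible upper triangular matrices, $\mathfrak b=\mathrm{Lie}\,B$ the upper triangular $n\times n$ matrices, $\mathfrak u\subseteq\mathfrak b$ the strictly upper triangular matrices and $\mathfrak u'=[\mathfrak u,\mathfrak u]$. Let $\mathfrak n$ be a Lie ideal of $\mathfrak b$ with $\mathfrak u'\subseteq\mathfrak n\subseteq\mathfrak u$, on which $B$ acts by conjugation, and let $\underline a=(a_0,a_1,\dots,a_r,a_{r+1})$ be the sequence attached to $\mathfrak n$ (see context). Put $e=\#\{i : 1\le i\le r,\ a_i \text{ even}\}$. Then: (1) $B$ acts on $\mathfrak n$ with a dense orbit if and only if $e\le 1$. (2) The minimal codimension in $\mathfrak n$ of a $B$-orbit (i.e. the codimension of a $B$-orbit of maximal dimension) equals $\max\{0,e-1\}$; in particular, if $B$ does not act on $\mathfrak n$ with a dense orbit, this codimension is $e-1$.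
   Context: Let $e_{i,j}$ denote the elementary matrix units. Let $\{i_0<i_1<\dots<i_r\}$ be the set of indices $i\in\{1,\dots,n-1\}$ with $e_{i,i+1}\in\mathfrak n$. Define $a_0=i_0$, $a_j=i_j-i_{j-1}$ for $1\le j\le r$, and $a_{r+1}=n-i_r$. (If no $e_{i,i+1}$ lies in $\mathfrak n$, the set of indices $1\le i\le r$ is empty and $e=0$.) *)

(* Defs.v *)
From HB Require Import structures.
From mathcomp Require Import all_boot all_order all_algebra.
From mathcomp Require Import mpoly.
Set Implicit Arguments. Unset Strict Implicit. Unset Printing Implicit Defensive.
Import GRing.Theory.
Local Open Scope ring_scope.

Section Defs.
Variables (k : fieldType) (n : nat).

Definition upper_tri (A : 'M[k]_n) : Prop := forall i j : 'I_n, (j < i)%N -> A i j = 0.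
Definition strict_upper (A : 'M[k]_n) : Prop := forall i j : 'I_n, (j <= i)%N -> A i j = 0.

Definition in_borel (g : 'M[k]_n) : Prop := g \in unitmx /\ upper_tri g.

Definition lie_br (X Y : 'M[k]_n) : 'M[k]_n := X *m Y - Y *m X.

Definition b_ideal (N : {vspace 'M[k]_n}) : Prop :=
  forall X Y, upper_tri X -> Y \in N -> lie_br X Y \in N.
(* u' = [u,u] is contained in N (N is a subspace, so containing all brackets
   of strictly upper triangular matrices is containing their span) *)
Definition contains_u' (N : {vspace 'M[k]_n}) : Prop :=
  forall X Y, strict_upper X -> strict_upper Y -> lie_br X Y \in N.
Definition inside_u (N : {vspace 'M[k]_n}) : Prop :=
  forall Y, Y \in N -> strict_upper Y.

Definition borbit (x : 'M[k]_n) (y : 'M[k]_n) : Prop :=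
  exists g, in_borel g /\ y = g *m x *m invmx g.

Definition E (i j : nat) : 'M[k]_n :=
  \matrix_(r < n, c < n) ((((r : nat) == i) && ((c : nat) == j))%:R : k).

(* 0-based list of indices i (i+1 < n) with e_{i,i+1} in N; shifting
   everything by 1 does not change the consecutive differences a_1..a_r *)
Definition simple_idx (N : {vspace 'M[k]_n}) : seq nat :=
  [seq i <- iota 0 n.-1 | E i i.+1 \in N].

Definition e_count (N : {vspace 'M[k]_n}) : nat :=
  match simple_idx N with
  | [::] => 0
  | i0 :: s => count (fun d => ~~ odd d) (pairmap (fun a b => b - a) i0 s)
  end%N.

Definition coords (y : 'M[k]_n) : 'I_(n * n) -> k := fun i => mxvec y 0 i.

Definition dense_orbit (N : {vspace 'M[k]_n}) : Prop :=
  exists x, x \in N /\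
    forall p : {mpoly k[n * n]},
      (forall y, borbit x y -> p.@[coords y] = 0) ->
      forall y, y \in N -> p.@[coords y] = 0.

(* dim_ge S d : the Zariski closure of S has dimension >= d, i.e. there are
   d coordinate functions algebraically independent on S (transcendence
   degree of the function field). *)
Definition dim_ge (S : 'M[k]_n -> Prop) (d : nat) : Prop :=
  exists f : 'I_d -> 'I_n * 'I_n,
    forall p : {mpoly k[d]}, p != 0 ->
      exists y, S y /\ p.@[fun i => y (f i).1 (f i).2] != 0.

End Defs.

(* Main.v *)
Require Import Defs.
From HB Require Import structures.
From mathcomp Require Import all_boot all_order all_algebra.
From mathcomp Require Import mpoly zify ring.
Set Implicit Arguments. Unset Strict Implicit. Unset Printing Implicit Defensive.
Import GRing.Theory.
Local Open Scope ring_scope.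

(* The matrices of the ideal are brought to a normal form made of two Jordan
   strands.  Label the positions 0, ..., n-1 by two letters so that equal
   consecutive letters occur only at simple positions i of the ideal (those
   with e_{i,i+1} in N) and one of the two letters, "true", is never doubled;
   i is a "turn" if it is simple and carries "true".  The first simple position
   can be arranged not to be a turn, and then a later one is a turn exactly when
   the gap to the previous one is even, so that there are e turns.  Let x_mu be
   the sum of the shifts along the two strands and of mu_t e_{t,t+1} over the
   turns t, and let W be the span of these e_{t,t+1}.

   Eliminating matrix units one after the other gives [b, x_mu] + W = N for all
   mu, while [b, x_mu] meets W in at most the line through the glue
   sum_t mu_t e_{t,t+1}; hence dim [b, x_mu] <= dim N - (e - 1).  The lowest
   homogeneous part of a polynomial along curves through x_0 shows that
   B.(x_0 + W) is dense in N, so the rank bound extends to all of N by minors.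
   The same argument at an x_mu with one nonzero mu_t, where a diagonal
   idempotent absorbs the direction e_{t,t+1}, produces the large orbit.  That
   an orbit has dimension at most dim [b, x], in any characteristic, follows by
   counting monomials against the values on a grid of parameters transversal to
   the centraliser. *)

(** * Polynomials over an algebraically closed field *)

Section Polynomials.
Variable k : closedFieldType.

Lemma ex_fresh (s : seq k) : exists x, x \notin s.
Proof.
have /closed_nonrootP[x]: \prod_(z <- s) ('X - z%:P) != 0 :> {poly k}.
  by rewrite monic_neq0 // monic_prod_XsubC.
by rewrite root_prod_XsubC; exists x.
Qed.

Lemma ex_uniq_seq (m : nat) : exists s : seq k, uniq s /\ size s = m.
Proof.
elim: m => [|m [s [us <-]]]; first by exists [::].
by have [x xs] := ex_fresh s; exists (x :: s); rewrite /= xs.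
Qed.

(** Digits in base [K] are unique; this keeps distinct monomials apart under the substitution
    below. *)
Lemma radix_inj (d K : nat) (a b : 'I_d -> nat) :
  (forall i, (a i < K)%N) -> (forall i, (b i < K)%N) ->
  (\sum_(i < d) a i * K ^ i)%N = (\sum_(i < d) b i * K ^ i)%N -> a =1 b.
Proof.
elim: d a b => [|d IH] a b aK bK; first by move=> _ [].
rewrite !big_ord_recl /= expn0 !muln1.
have shift (c : 'I_d.+1 -> nat) : (\sum_(i < d) c (lift ord0 i) * K ^ bump 0 i
    = (\sum_(i < d) c (lift ord0 i) * K ^ i) * K)%N.
  by rewrite big_distrl /=; apply: eq_bigr => i _; rewrite /bump leq0n add1n expnSr mulnA.
rewrite !shift => eqab.
have K0 : (0 < K)%N by apply: leq_ltn_trans (aK ord0).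
have e0 : a ord0 = b ord0.
  by move/(congr1 (modn^~ K)): eqab; rewrite /= ![(_ + _ * K)%N]addnC !modnMDl !modn_small.
move: eqab; rewrite e0 => /addnI/eqP; rewrite eqn_pmul2r // => /eqP eqab i.
have [j ->|->//] := unliftP ord0 i.
exact: (IH (fun i => a (lift ord0 i)) (fun i => b (lift ord0 i))).
Qed.

(* Kronecker substitution [X_i := t ^ (K ^ i)] *)
Lemma mpoly_nonvanishing (d : nat) (p : {mpoly k[d]}) :
  p != 0 -> exists v, p.@[v] != 0.
Proof.
move=> p0; pose K := (\max_(m <- msupp p) \max_(i < d) m i).+1.
have mK (m : 'X_{1..d}) : m \in msupp p -> forall i, (m i < K)%N.
  move=> mp i; rewrite ltnS; apply: leq_trans (leq_bigmax (F := fun i => m i) i) _.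
  exact: (bigmaxn_sup_seq m mp).
pose ex (m : 'X_{1..d}) := (\sum_(i < d) m i * K ^ i)%N.
pose Q : {poly k} := \sum_(m <- msupp p) p@_m *: 'X^(ex m).
have Qv x : Q.[x] = p.@[fun i => x ^+ (K ^ i)].
  rewrite horner_sum mevalE; apply: eq_bigr => m _.
  rewrite hornerZ hornerXn /ex; congr (_ * _).
  rewrite -prodrXr; apply: eq_bigr => i _.
  by rewrite -exprM mulnC.
have /hasP[m0 m0p _] : has predT (msupp p).
  by rewrite has_predT lt0n size_eq0 msupp_eq0.
have Q0 : Q != 0.
  apply/eqP => /(congr1 (fun q : {poly k} => q`_(ex m0))); rewrite coef0 coef_sum.
  rewrite (bigD1_seq m0) ?msupp_uniq //= coefZ coefXn eqxx mulr1 big_seq_cond big1.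
    by rewrite addr0 => /eqP; apply/negP; rewrite -mcoeff_msupp.
  move=> m /andP[mp /eqP neq]; rewrite coefZ coefXn; case: eqP; rewrite ?mulr0 // => eqm.
  by case: neq; apply/mnmP => i; symmetry; apply: (radix_inj (mK _ m0p) (mK _ mp) eqm).
by have /closed_nonrootP[x] := Q0; exists (fun i => x ^+ (K ^ i)); rewrite -Qv.
Qed.

Lemma meval_shift (d : nat) (p : {mpoly k[d]}) (z : 'I_d -> k) :
  exists q : {mpoly k[d]}, forall v, q.@[v] = p.@[fun i => z i + v i].
Proof.
exists (p \mPo [tuple 'X_i + (z i)%:MP | i < d]) => v.
rewrite comp_mpoly_meval; apply: meval_eq => i.
by rewrite tnth_mktuple mevalD mevalXU mevalC addrC.
Qed.

(* The direction [c] is one where the lowest homogeneous part of [p] at [z]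
   does not vanish; it dominates along every curve leaving [z] in direction [c]. *)
Lemma curve_nonvanishing (d : nat) (p : {mpoly k[d]}) (z : 'I_d -> k) :
  p != 0 -> exists c : 'I_d -> k,
    forall (V : 'I_d -> {poly k}) (D : {poly k}),
      (forall i, (V i).[0] = c i) -> D.[0] != 0 ->
      exists t, D.[t] != 0 /\ p.@[fun i => z i + t * (V i).[t] / D.[t]] != 0.
Proof.
move=> p0; have [q qE] := meval_shift p z.
have q0 : q != 0.
  have [v pv] := mpoly_nonvanishing p0.
  apply/eqP => q0; have := qE (fun i => v i - z i); rewrite q0 meval0 => e.
  move: pv; rewrite (meval_eq (v2 := fun i => z i + (v i - z i))) -?e ?eqxx //.
  by move=> i; rewrite addrC subrK.
have [m0 m0q m0min] : exists2 m0, m0 \in msupp q &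
    forall m, m \in msupp q -> (mdeg m0 <= mdeg m)%N.
  have /hasP[m1 m1q _] : has predT (msupp q).
    by rewrite has_predT lt0n size_eq0 msupp_eq0.
  have exm : exists e, has (fun m => mdeg m == e) (msupp q).
    by exists (mdeg m1); apply/hasP; exists m1.
  case: (ex_minnP exm) => e /hasP[m0 m0q /eqP me] emin.
  exists m0 => // m mq; rewrite me; apply: emin; by apply/hasP; exists m.
pose l : {mpoly k[d]} := \sum_(m <- msupp q | mdeg m == mdeg m0) q@_m *: 'X_[m].
have l0 : l != 0.
  apply/eqP => /(congr1 (mcoeff m0)); rewrite mcoeff0 raddf_sum /=.
  rewrite big_mkcond (bigD1_seq m0) ?msupp_uniq //= eqxx mcoeffZ mcoeffX eqxx mulr1 big1.
    by rewrite addr0 => /eqP; apply/negP; rewrite -mcoeff_msupp.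
  by move=> m /negbTE mn; case: ifP => // _; rewrite mcoeffZ mcoeffX mn mulr0.
have [c lc] := mpoly_nonvanishing l0.
exists c => V D V0 D0.
pose M := (\max_(m <- msupp q) mdeg m)%N.
have mM m : m \in msupp q -> (mdeg m <= M)%N.
  by move=> mq; exact: (bigmaxn_sup_seq m mq).
(* [G] is [q] along the curve, cleared of denominators by [D ^+ M] and divided by [t ^+ mdeg m0]; at
   0 only the lowest part [l] survives. *)
pose G : {poly k} := \sum_(m <- msupp q)
  q@_m *: ('X^(mdeg m - mdeg m0) * (\prod_(i < d) V i ^+ m i) * D ^+ (M - mdeg m)).
have G0 : G.[0] != 0.
  have -> : G.[0] = l.@[c] * D.[0] ^+ (M - mdeg m0).
    rewrite horner_sum raddf_sum /= big_distrl /= [RHS]big_mkcond /=.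
    rewrite big_seq [RHS]big_seq; apply: eq_bigr => m mq.
    rewrite hornerZ !hornerM hornerXn !horner_exp horner_prod.
    case: eqP => [->|/eqP neq].
      rewrite subnn expr0 mul1r mevalZ mevalX -mulrA; congr (_ * (_ * _)).
      by apply: eq_bigr => i _; rewrite horner_exp V0.
    have lt : (0 < mdeg m - mdeg m0)%N by have := m0min _ mq; lia.
    by rewrite expr0n eqn0Ngt lt !mul0r mulr0.
  by rewrite mulf_neq0 // expf_neq0.
have /closed_nonrootP[t] : G * D * 'X != 0.
  rewrite !mulf_neq0 ?polyX_eq0 //.
    by apply: contraNneq G0 => ->; rewrite horner0.
  by apply: contraNneq D0 => ->; rewrite horner0.
rewrite /root !hornerM hornerX !mulf_eq0 !negb_or => /andP[/andP[Gt Dt] t0].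
exists t; split=> //; rewrite -qE.
suff e : D.[t] ^+ M * q.@[fun i => t * (V i).[t] / D.[t]] = t ^+ mdeg m0 * G.[t].
  have : D.[t] ^+ M * q.@[fun i => t * (V i).[t] / D.[t]] != 0.
    by rewrite e mulf_neq0 // expf_neq0.
  by rewrite mulf_eq0 negb_or => /andP[].
rewrite mevalE horner_sum !big_distrr /= big_seq [RHS]big_seq.
apply: eq_bigr => m mq; rewrite hornerZ !hornerM hornerXn horner_exp horner_prod.
have -> : \prod_i (t * (V i).[t] / D.[t]) ^+ m i =
   t ^+ mdeg m * (\prod_(i < d) (V i ^+ m i).[t]) / D.[t] ^+ mdeg m.
  rewrite mdegE -!prodrXr -prodfV -!big_split /=; apply: eq_bigr => i _.
  by rewrite !exprMn exprVn horner_exp.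
have -> : t ^+ mdeg m = t ^+ mdeg m0 * t ^+ (mdeg m - mdeg m0).
  by rewrite -exprD subnKC // m0min.
rewrite -(subnK (mM _ mq)) exprD addnK.
move: (expf_neq0 (mdeg m) Dt); move: (\prod_(i < d) _) (D.[t] ^+ mdeg m).
move: (D.[t] ^+ _) (q@_m) (t ^+ mdeg m0) (t ^+ _) => a b u v w y y0.
by field.
Qed.

End Polynomials.

(** * Upper triangular matrices and dominance of orbit maps *)

Section CoordinateSubspaces.
Variables (k : fieldType) (n : nat).
Implicit Types (P Q : pred ('I_n * 'I_n)) (X Y : 'M[k]_n).

Definition cproj P X : 'M[k]_n := \matrix_(i, j) if P (i, j) then X i j else 0.

Lemma cproj_is_linear P : linear (cproj P).
Proof.
move=> a X Y; apply/matrixP=> i j; rewrite !mxE.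
by case: ifP; rewrite ?mulr0 ?addr0.
Qed.
HB.instance Definition _ P :=
  GRing.isLinear.Build k 'M[k]_n 'M[k]_n _ (cproj P) (cproj_is_linear P).

Lemma cprojD P X Y : cproj P (X + Y) = cproj P X + cproj P Y.
Proof. exact: linearD. Qed.

Lemma cprojZ P a X : cproj P (a *: X) = a *: cproj P X.
Proof. exact: linearZ. Qed.

Definition coordsp P : {vspace 'M[k]_n} := limg (linfun (cproj P)).

Lemma coordspP P Y : reflect (forall i j, ~~ P (i, j) -> Y i j = 0) (Y \in coordsp P).
Proof.
apply: (iffP idP) => [/memv_imgP[X _ ->] i j /negbTE nP|Y0].
  by rewrite lfunE /= mxE nP.
apply/memv_imgP; exists Y; rewrite ?memvf // lfunE /=.
by apply/matrixP=> i j; rewrite mxE; case: ifPn => // /Y0.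
Qed.

Lemma dim_coordsp P : \dim (coordsp P) = #|P|.
Proof.
pose s := [seq delta_mx p.1 p.2 : 'M[k]_n | p <- enum P].
have -> : coordsp P = <<s>>%VS.
  apply/eqP; rewrite eqEsubv; apply/andP; split; last first.
    apply/span_subvP => _ /mapP[p pP ->]; apply/coordspP => i j nP; rewrite mxE.
    case: eqP => [ei|//]; case: eqP => [ej|//]; move: nP; rewrite ei ej -surjective_pairing.
    by rewrite mem_enum in pP => /negP[].
  apply/subvP => Y /coordspP Y0.
  rewrite [Y]matrix_sum_delta; apply: memv_suml => i _; apply: memv_suml => j _.
  case Pij : (P (i, j)); last by rewrite Y0 ?Pij // scale0r mem0v.
  apply/memvZ/memv_span/mapP; exists (i, j) => //; by rewrite mem_enum.
suff /eqP -> : free s by rewrite size_map -cardE.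
rewrite -[s]/(tval (in_tuple s)); apply/freeP => c c0 i.
have sz : size s = size (enum P) by rewrite size_map.
have i_lt : (i < size (enum P))%N by rewrite -sz.
pose p0 := tnth (in_tuple (enum P)) (cast_ord sz i).
pose p := nth p0 (enum P).
have := congr1 (fun M : 'M[k]_n => M (p i).1 (p i).2) c0; rewrite mxE summxE.
rewrite (bigD1 i) //= big1 => [|j ji].
  rewrite addr0 (nth_map p0) // !mxE !eqxx mulr1; exact.
have j_lt : (j < size (enum P))%N by rewrite -sz.
rewrite (nth_map p0) // !mxE; case: eqP => [e1|]; last by rewrite mulr0.
case: eqP => [e2|]; last by rewrite mulr0.
case/eqP: ji; apply/val_inj/eqP; rewrite /= -(nth_uniq p0 j_lt i_lt (enum_uniq _)).
by rewrite [nth p0 _ i]surjective_pairing e1 e2 -surjective_pairing.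
Qed.

Definition upper_pos : pred ('I_n * 'I_n) := fun p => (p.1 <= p.2)%N.

Lemma upper_triP X : reflect (upper_tri X) (X \in coordsp upper_pos).
Proof.
apply: (iffP (coordspP _ _)) => H i j; first by move=> ji; apply: H; rewrite /upper_pos /= -ltnNge.
by rewrite /upper_pos /= -ltnNge => /H.
Qed.

Lemma upper_triM X Y : upper_tri X -> upper_tri Y -> upper_tri (X *m Y).
Proof.
move=> uX uY i j ji; rewrite mxE big1 // => l _.
have [li|il] := ltnP l i; first by rewrite uX // mul0r.
by rewrite uY ?mulr0 // (leq_trans ji).
Qed.

Lemma upper_tri1 : upper_tri (1%:M : 'M[k]_n).
Proof. by move=> i j ji; rewrite mxE -val_eqE gtn_eqF. Qed.

Lemma upper_triD X Y : upper_tri X -> upper_tri Y -> upper_tri (X + Y).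
Proof. by move=> /upper_triP uX /upper_triP uY; apply/upper_triP; rewrite memvD. Qed.

Lemma upper_triZ a X : upper_tri X -> upper_tri (a *: X).
Proof. by move=> /upper_triP uX; apply/upper_triP; rewrite memvZ. Qed.

Lemma upper_tri_cproj X : upper_tri (cproj upper_pos X).
Proof. by apply/upper_triP; rewrite -[cproj _ X]lfunE memv_img ?memvf. Qed.

Lemma cproj_upper_tri X : upper_tri X -> cproj upper_pos X = X.
Proof.
move=> uX; apply/matrixP => i j; rewrite mxE; case: ifPn => //.
by rewrite /upper_pos /= -ltnNge => /uX.
Qed.

(* Left multiplication by g is an injective endomorphism of the
   finite-dimensional space of upper triangular matrices, so 1 is in its image. *)
Lemma upper_tri_inv X : in_borel X -> upper_tri (invmx X).
Proof.
case=> Xu uX; pose f : 'M[k]_n -> 'M[k]_n := mulmx X.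
pose F := linfun f; pose b := coordsp upper_pos.
have ker0 : lker F == 0%VS.
  by apply/lker0P => Y Z; rewrite !lfunE /= => /(congr1 (mulmx (invmx X))); rewrite !mulKmx.
have Fb : (F @: b <= b)%VS.
  apply/subvP => _ /memv_imgP[Y /upper_triP uY ->]; rewrite lfunE /=.
  by apply/upper_triP/upper_triM.
have : 1%:M \in (F @: b)%VS.
  have -> : (F @: b)%VS = b.
    apply/eqP; rewrite eqEdim Fb /= limg_dim_eq //.
    by move/eqP: ker0 => ->; rewrite capv0.
  exact/upper_triP/upper_tri1.
case/memv_imgP => Y /upper_triP uY; rewrite lfunE /= /f => e.
by rewrite -[invmx X]mulmx1 e mulKmx.
Qed.

End CoordinateSubspaces.

Lemma horner_map_mxC (R : comNzRingType) (m n : nat) (t : R) (M : 'M[R]_(m, n)) :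
  map_mx (horner_eval t) (map_mx polyC M) = M.
Proof. by apply/matrixP => i j; rewrite !mxE /horner_eval hornerC. Qed.

(** * Polynomials that do not vanish on B.(x + W) *)

Section Dominance.
Variables (k : closedFieldType) (n : nat).
Implicit Types (x X w : 'M[k]_n).

Let C (M : 'M[k]_n) : 'M[{poly k}]_n := map_mx polyC M.

(** For g = 1 + tX one has g (x + t w) g^-1 = x + t ([X, x] + w + t X w) g^-1, a curve leaving [x]
    in the direction [X, x] + w; by hypothesis every direction [c] of the coordinates [f] arises in
    this way. *)
Lemma orbit_dominant (d : nat) (f : 'I_d -> 'I_n * 'I_n) (x : 'M[k]_n)
    (W : {vspace 'M[k]_n}) (p : {mpoly k[d]}) :
  (forall c : 'I_d -> k, exists X w,
     [/\ upper_tri X, w \in W & forall i, (lie_br X x + w) (f i).1 (f i).2 = c i]) ->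
  p != 0 ->
  exists g w, [/\ in_borel g, w \in W &
    p.@[fun i => (g *m (x + w) *m invmx g) (f i).1 (f i).2] != 0].
Proof.
move=> surj /(curve_nonvanishing (fun i => x (f i).1 (f i).2))[c curve].
have [X [w [uX wW Xw]]] := surj c.
pose G : 'M[{poly k}]_n := 1%:M + 'X *: C X.
have Gt t : map_mx (horner_eval t) G = 1%:M + t *: X.
  by rewrite map_mxD map_mx1 map_mxZ horner_map_mxC /= /horner_eval hornerX.
pose V := (C (lie_br X x + w) + 'X *: (C X *m C w)) *m \adj G.
have Vt t : map_mx (horner_eval t) V =
    (lie_br X x + w + t *: (X *m w)) *m \adj (1%:M + t *: X).
  rewrite map_mxM map_mxD map_mxZ map_mxM !horner_map_mxC map_mx_adj Gt /=.
  by rewrite /horner_eval hornerX.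
have Dt t : (\det G).[t] = \det (1%:M + t *: X).
  by rewrite -[LHS]/(horner_eval t _) -det_map_mx Gt.
have V0 i : (V (f i).1 (f i).2).[0] = c i.
  have := congr1 (fun M : 'M_n => M (f i).1 (f i).2) (Vt 0).
  by rewrite mxE /horner_eval => ->; rewrite !scale0r !addr0 adj1 mulmx1 Xw.
have D0 : (\det G).[0] != 0 by rewrite Dt scale0r addr0 det1 oner_eq0.
have [t [Dt0 pt]] := curve (fun i => V (f i).1 (f i).2) (\det G) V0 D0.
rewrite Dt in Dt0 pt; set g := 1%:M + t *: X in Dt0 pt.
have gu : g \in unitmx by rewrite unitmxE unitfE.
exists g, (t *: w); split; [split=> // | by rewrite memvZ |].
  by apply: upper_triD; [exact: upper_tri1 | exact: upper_triZ].
have conj : g *m (x + t *: w) *m invmx g =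
    x + (t / \det g) *: ((lie_br X x + w + t *: (X *m w)) *m \adj g).
  rewrite -[RHS](mulmxK gu); congr (_ *m _).
  rewrite [RHS]mulmxDl -[X in _ = _ + X]scalemxAl -(mulmxA _ (\adj g) g).
  rewrite mul_adj_mx mul_mx_scalar scalerA divfK // /g /lie_br.
  rewrite !(mulmxDl, mulmxDr, mul1mx, mulmx1) -!(scalemxAl, scalemxAr).
  rewrite !scalerDr scalerN !scalerA -!addrA; congr (_ + _).
  apply/matrixP => i j; rewrite !mxE; ring.
rewrite conj (meval_eq (v2 := fun i => x (f i).1 (f i).2 + t * (V (f i).1 (f i).2).[t] / \det g)) //.
move=> i; rewrite [LHS]mxE [X in _ + X]mxE -Vt [X in _ * X]mxE /horner_eval.
by rewrite mulrAC.
Qed.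

End Dominance.

(** * The dimension of an orbit is at most that of its tangent space *)

Section Degree.
Variable k : fieldType.
Implicit Types p q : {poly k}.

Definition deg_le (m : nat) p := (size p <= m.+1)%N.

Lemma deg_leW m m' p : (m <= m')%N -> deg_le m p -> deg_le m' p.
Proof. by move=> mm' /leq_trans; apply; rewrite ltnS. Qed.

Lemma deg_leC c : deg_le 0 c%:P.
Proof. exact: size_polyC_leq1. Qed.

Lemma deg_le_sign e : deg_le 0 ((-1) ^+ e).
Proof. by rewrite /deg_le -[_ ^+ _]mulr1 size_Msign size_poly1. Qed.

Lemma deg_leX : deg_le 1 'X.
Proof. by rewrite /deg_le size_polyX. Qed.

Lemma deg_leM m m' p q : deg_le m p -> deg_le m' q -> deg_le (m + m') (p * q).
Proof.
move=> pm qm; apply: leq_trans (size_polyMleq _ _) _.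
by move: pm qm; rewrite /deg_le; lia.
Qed.

Lemma deg_leD m p q : deg_le m p -> deg_le m q -> deg_le m (p + q).
Proof. by move=> pm qm; apply: leq_trans (size_polyD _ _) _; rewrite geq_max; apply/andP. Qed.

Lemma deg_le_sum m (I : finType) (F : I -> {poly k}) :
  (forall i, deg_le m (F i)) -> deg_le m (\sum_i F i).
Proof.
move=> Fm; elim/big_ind: _ => [|p q|i _ //].
  by rewrite /deg_le size_poly0.
exact: deg_leD.
Qed.

Lemma deg_le_prod (I : finType) (m : I -> nat) (F : I -> {poly k}) :
  (forall i, deg_le (m i) (F i)) -> deg_le (\sum_i m i) (\prod_i F i).
Proof.
move=> Fm; elim/big_ind2: _ => [|p1 p2 q1 q2|i _ //].
  by rewrite -[1]polyC1; exact: deg_leC.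
exact: deg_leM.
Qed.

Lemma deg_leXn m e p : deg_le m p -> deg_le (m * e) (p ^+ e).
Proof.
move=> pm; elim: e => [|e IH]; first by rewrite muln0 expr0 -[1]polyC1; exact: deg_leC.
by rewrite exprS mulnS; exact: deg_leM.
Qed.

Lemma deg_le_det (n : nat) (A : 'M[{poly k}]_n) :
  (forall i j, deg_le 1 (A i j)) -> deg_le n (\det A).
Proof.
move=> A1; apply: deg_le_sum => s; apply: (deg_leM (m := 0)); first exact: deg_le_sign.
apply: (deg_leW (m := \sum_(i < n) 1)); last by apply: deg_le_prod.
by rewrite sum1_card card_ord.
Qed.

Lemma deg_le_adj (n : nat) (A : 'M[{poly k}]_n) i j :
  (forall i j, deg_le 1 (A i j)) -> deg_le n.-1 (\adj A i j).
Proof.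
move=> A1; rewrite mxE /cofactor; apply: (deg_leM (m := 0)); first exact: deg_le_sign.
by apply: deg_le_det => i' j'; rewrite !mxE.
Qed.

End Degree.

(** * Linear dependencies and vanishing on grids *)

Section Counting.
Variable k : fieldType.

Lemma exists_dependency (A B : finType) (F : A -> B -> k) : (#|B| < #|A|)%N ->
  exists2 v : A -> k, (exists a, v a != 0) & forall b, \sum_a v a * F a b = 0.
Proof.
move=> BA; pose M : 'M[k]_(#|A|, #|B|) := \matrix_(a, b) F (enum_val a) (enum_val b).
have nz : nz_row (kermx M) != 0.
  rewrite nz_row_eq0 kermx_eq0 /row_free; apply: contraTneq BA => <-.
  by rewrite -leqNgt rank_leq_col.
exists (fun a => nz_row (kermx M) 0 (enum_rank a)).
  have [j nzj] : exists j, nz_row (kermx M) 0 j != 0.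
    apply/existsP; apply: contraR nz; rewrite negb_exists => /forallP z.
    by apply/eqP/rowP => j; rewrite !mxE; apply/eqP; rewrite -[_ == _]negbK z.
  by exists (enum_val j); rewrite enum_valK.
move=> b; have /sub_kermxP/rowP/(_ (enum_rank b)) := nz_row_sub (kermx M).
rewrite !mxE => e; rewrite -[RHS]e (reindex _ (onW_bij _ (@enum_val_bij A))) /=.
by apply: eq_bigr => a _; rewrite enum_valK !mxE !enum_rankK.
Qed.

Definition upd (r : nat) (s : {ffun 'I_r -> k}) (i : 'I_r) (t : k) :=
  [ffun j => if j == i then t else s j].

(** The variables leave the grid one at a time: along each coordinate line a polynomial of degree at
    most [K] with more than [K] roots is zero. *)
Lemma grid_vanishing (r K : nat) (S : seq k) (F : {ffun 'I_r -> k} -> k) :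
  uniq S -> (K < size S)%N ->
  (forall s i, exists2 q : {poly k}, deg_le K q & forall t, F (upd s i t) = q.[t]) ->
  (forall s : {ffun 'I_r -> k}, (forall i, s i \in S) -> F s = 0) ->
  forall s, F s = 0.
Proof.
move=> uS KS Fpoly Fgrid s.
suff claim (j : nat) : (j <= r)%N ->
    forall s : {ffun 'I_r -> k}, (forall i : 'I_r, (j <= i)%N -> s i \in S) -> F s = 0.
  by apply: (claim r) => // i; rewrite leqNgt ltn_ord.
elim: j => [|j IH] jr {}s sS; first by apply: Fgrid => i; apply: sS.
pose i := Ordinal jr; have [q qK qE] := Fpoly s i.
have <- : upd s i (s i) = s by apply/ffunP => l; rewrite ffunE; case: eqP => // ->.
suff q0 : q = 0 by rewrite qE q0 horner0.
apply: (roots_geq_poly_eq0 _ uS); last exact: leq_trans qK _.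
apply/allP => t tS; rewrite /root -qE; apply/eqP/IH; first exact: ltnW.
move=> l jl; rewrite ffunE; case: eqP => [//|/eqP li]; apply: sS.
by rewrite ltn_neqAle jl andbT eq_sym; apply: contraNneq li => e; apply/eqP/val_inj.
Qed.

End Counting.

Section Tangent.
Variables (k : fieldType) (n : nat).
Implicit Types x X : 'M[k]_n.

Definition upper_ad x X : 'M[k]_n := lie_br (cproj (@upper_pos n) X) x.

Lemma upper_ad_is_linear x : linear (upper_ad x).
Proof.
move=> a X Y; rewrite /upper_ad /lie_br linearP /= mulmxDl mulmxDr.
by rewrite -scalemxAl -scalemxAr scalerBr opprD addrACA.
Qed.
HB.instance Definition _ x :=
  GRing.isLinear.Build k 'M[k]_n 'M[k]_n _ (upper_ad x) (upper_ad_is_linear x).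

(** The image [b, x] of the differential at 1 of the orbit map. *)
Definition tangent x : {vspace 'M[k]_n} := limg (linfun (upper_ad x)).

Lemma tangentP x Y : reflect (exists2 X, upper_tri X & Y = lie_br X x) (Y \in tangent x).
Proof.
apply: (iffP memv_imgP) => [[X _ ->]|[X uX ->]].
  by rewrite lfunE; exists (cproj (@upper_pos n) X) => //; exact: upper_tri_cproj.
by exists X; rewrite ?memvf // lfunE /= /upper_ad cproj_upper_tri.
Qed.

(** The [u i] span a complement, in b, of the centraliser of [x]; by rank and nullity their number
    is the dimension of [b, x]. *)
Lemma upper_decomposition x : exists u : 'I_(\dim (tangent x)) -> 'M[k]_n,
  (forall i, upper_tri (u i)) /\
  forall X, exists h (s : 'I_(\dim (tangent x)) -> k),
    [/\ upper_tri h, h *m x = x *m h & cproj (@upper_pos n) X = \sum_i s i *: u i + h].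
Proof.
pose f := linfun (upper_ad x); pose U := ((lker f)^C)%VS.
have dU : \dim U = \dim (tangent x).
  by rewrite dimv_compl -[\dim fullv](limg_ker_dim f) capfv addKn.
rewrite -dU; exists (fun i => cproj (@upper_pos n) (vbasis U)`_i); split=> [i|X].
  exact: upper_tri_cproj.
have : X \in (lker f + U)%VS by rewrite addv_complf memvf.
case/memv_addP => h hk [w wU ->].
exists (cproj (@upper_pos n) h), (fun i => coord (vbasis U) i w); split.
- exact: upper_tri_cproj.
- by move: hk; rewrite memv_ker lfunE /= => /eqP /subr0_eq.
rewrite linearD /= addrC; congr (_ + _).
by rewrite [in LHS](coord_vbasis wU) linear_sum; apply: eq_bigr => i _; rewrite linearZ.
Qed.

End Tangent.

(** * Monomials in the coordinates of an orbit *)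

Section OrbitMonomials.
Variables (n d : nat) (f : 'I_d -> 'I_n * 'I_n) (D : nat).

(* [\det g ^+ D] times the monomial of exponent [a] in the coordinates [f] of
   [g x g^-1]: the power of the determinant clears the denominators. *)
Definition orbit_monomial (R : comNzRingType) (a : 'I_d -> nat) (x g : 'M[R]_n) : R :=
  \det g ^+ (D - \sum_i a i) * \prod_i (g *m x *m \adj g) (f i).1 (f i).2 ^+ a i.

(** Naturality allows reading the same expression at a matrix, on a line of matrices and at a
    generic matrix. *)
Lemma map_orbit_monomial (R S : comNzRingType) (h : {rmorphism R -> S}) a (x g : 'M[R]_n) :
  orbit_monomial a (map_mx h x) (map_mx h g) = h (orbit_monomial a x g).
Proof.
rewrite /orbit_monomial rmorphM rmorphXn rmorph_prod det_map_mx; congr (_ * _).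
by apply: eq_bigr => i _; rewrite rmorphXn -map_mx_adj -!map_mxM mxE.
Qed.

Variables (k : fieldType).
Implicit Types x g w : 'M[k]_n.

Lemma orbit_monomial_unit (a : 'I_d -> nat) x g : (\sum_i a i <= D)%N -> g \in unitmx ->
  orbit_monomial a x g =
  \det g ^+ D * \prod_i (g *m x *m invmx g) (f i).1 (f i).2 ^+ a i.
Proof.
move=> aD gu; rewrite -[in RHS](subnK aD) exprD -mulrA; congr (_ * _).
rewrite -prodrXr -big_split /=; apply: eq_bigr => i _.
rewrite -exprMn; congr (_ ^+ _); rewrite /invmx gu -scalemxAr [in RHS]mxE mulrA mulrV ?mul1r //.
Qed.

(** Along a line [\det g] and every entry of [g *m x *m \adj g] have degree at most [n], the latter
    as 1 + (n - 1); there are [D] such factors in all. *)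
Lemma orbit_monomial_line (a : 'I_d -> nat) x g w : (\sum_i a i <= D)%N ->
  exists2 q : {poly k}, deg_le (n * D) q & forall t, orbit_monomial a x (g + t *: w) = q.[t].
Proof.
move=> aD; pose C (M : 'M[k]_n) : 'M[{poly k}]_n := map_mx polyC M.
pose G := C g + 'X *: C w.
have G1 i j : deg_le 1 (G i j).
  rewrite !mxE; apply: deg_leD; first by apply: deg_leW (deg_leC _).
  exact: (deg_leM (m := 1) (m' := 0) (deg_leX _) (deg_leC _)).
exists (orbit_monomial a (C x) G) => [|t]; last first.
  rewrite -[RHS]/(horner_eval t _) -map_orbit_monomial horner_map_mxC.
  by rewrite map_mxD map_mxZ !horner_map_mxC /= /horner_eval hornerX.
have -> : (n * D = n * (D - \sum_i a i) + n * \sum_i a i)%N by rewrite -mulnDr subnK.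
apply: deg_leM.
  exact: deg_leXn (deg_le_det G1).
rewrite big_distrr /=; apply: deg_le_prod => i; apply: deg_leXn.
have n0 : (0 < n)%N by apply: leq_ltn_trans (ltn_ord (f i).1).
rewrite mxE; apply: deg_le_sum => l; rewrite -[n in deg_le n](prednK n0) -add1n.
apply: deg_leM; last exact: deg_le_adj.
rewrite mxE; apply: deg_le_sum => m; apply: (deg_leM (m := 1) (m' := 0)) => //.
by rewrite mxE; exact: deg_leC.
Qed.

End OrbitMonomials.

Section OrbitDimension.
Variables (k : closedFieldType) (n : nat).

Let X_ : 'M[{mpoly k[n * n]}]_n :=
  \matrix_(i, j) if (i <= j)%N then 'X_(mxvec_index i j) else 0.

Lemma meval_generic (Z : 'M[k]_n) :
  map_mx (meval (coords Z)) X_ = cproj (@upper_pos n) Z.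
Proof.
apply/matrixP => i j; rewrite !mxE /upper_pos /=.
by case: ifP => _; rewrite ?meval0 // mevalXU /coords mxvecE.
Qed.

(* g and g h have the same image in the orbit when h centralises x, and the
   products (1 + \sum_j s j *: u j) h are Zariski dense in the group; so a
   polynomial on the orbit is controlled by its values on the r-parameter
   family s, and there are more monomials in d > r coordinates than values to
   be killed on a grid. *)
Lemma orbit_equation (x : 'M[k]_n) (d : nat) (f : 'I_d -> 'I_n * 'I_n) :
  (\dim (tangent x) < d)%N -> exists2 p : {mpoly k[d]}, p != 0 &
    forall y, borbit x y -> p.@[fun i => y (f i).1 (f i).2] = 0.
Proof.
set r := \dim _ => rd.
have [u [uu decomp]] := upper_decomposition x; rewrite -/r in u uu decomp.
(* Exponents below [N0] give [N0 ^ d] monomials, while the grid has [(n * D).+1 ^ r] points, at most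
   [(n * d).+1 ^ r * N0 ^ r < N0 ^ r.+1 <= N0 ^ d]. *)
pose N0 := ((n * d).+1 ^ r).+1; pose D := (d * N0)%N.
have aD (a : {ffun 'I_d -> 'I_N0}) : (\sum_i a i <= D)%N.
  have -> : D = (\sum_(i < d) N0)%N by rewrite sum_nat_const card_ord.
  by apply: leq_sum => i _; exact: ltnW.
have [S [uS sS]] := ex_uniq_seq k (n * D).+1.
pose Gr (b : {ffun 'I_r -> 'I_(n * D).+1}) : {ffun 'I_r -> k} := [ffun i => S`_(b i)].
pose U (s : {ffun 'I_r -> k}) : 'M[k]_n := 1%:M + \sum_i s i *: u i.
pose F (a : {ffun 'I_d -> 'I_N0}) g := orbit_monomial f D (fun i => a i) x g.
have [|v [a0 va0] vF] := @exists_dependency k _ _ (fun a b => F a (U (Gr b))).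
  rewrite !card_ffun !card_ord.
  apply: (@leq_ltn_trans ((n * d).+1 ^ r * N0 ^ r)).
    have mono a b e : (a <= b -> a ^ e <= b ^ e)%N by case: e => // e ab; rewrite leq_exp2r.
    by rewrite -expnMn; apply: mono; rewrite /D; nia.
  by apply: (@leq_trans (N0 * N0 ^ r)); rewrite ?ltn_pmul2r ?expn_gt0 // -expnS leq_pexp2l.
pose P g := \sum_a v a * F a g.
have PU s : P (U s) = 0.
  move: s; apply: (grid_vanishing uS (K := (n * D)%N)); rewrite ?sS //.
    move=> s i; pose g := U (upd s i 0).
    have e t : U (upd s i t) = g + t *: u i.
      rewrite /g /U -addrA; congr (_ + _); rewrite (bigD1 i) //= [in RHS](bigD1 i) //=.
      rewrite !ffunE eqxx scale0r add0r addrC; congr (_ + _).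
      by apply: eq_bigr => j ji; rewrite !ffunE (negbTE ji).
    have /fin_all_exists2[q qD qE] (a : {ffun 'I_d -> 'I_N0}) :=
      orbit_monomial_line f x g (u i) (aD a).
    exists (\sum_a v a *: q a) => [|t].
      apply: deg_le_sum => a; rewrite -mul_polyC.
      exact: (deg_leM (m := 0) (deg_leC _) (qD a)).
    by rewrite horner_sum; apply: eq_bigr => a _; rewrite hornerZ -qE e.
  move=> s sin; pose b : {ffun 'I_r -> 'I_(n * D).+1} := [ffun i => inord (index (s i) S)].
  have -> : s = Gr b; last exact: vF.
  by apply/ffunP => i; rewrite !ffunE inordK ?nth_index // -sS index_mem.
pose p : {mpoly k[d]} := \sum_a v a *: 'X_[[multinom (a i : nat) | i < d]].
have pE y : p.@[y] = \sum_(a : {ffun 'I_d -> 'I_N0}) v a * \prod_i y i ^+ a i.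
  rewrite raddf_sum /=; apply: eq_bigr => a _; rewrite mevalZ mevalX; congr (_ * _).
  by apply: eq_bigr => i _; rewrite mnmE.
have Punit g : g \in unitmx ->
    P g = \det g ^+ D * p.@[fun i => (g *m x *m invmx g) (f i).1 (f i).2].
  move=> gu; rewrite pE big_distrr /=; apply: eq_bigr => a _.
  by rewrite /F orbit_monomial_unit // mulrCA.
have p0 : p != 0.
  apply/eqP => /(congr1 (mcoeff [multinom (a0 i : nat) | i < d])).
  rewrite mcoeff0 raddf_sum /= (bigD1 a0) //= mcoeffZ mcoeffX eqxx mulr1 big1.
    by rewrite addr0 => /eqP; exact/negP.
  move=> a aa0; rewrite mcoeffZ mcoeffX; case: eqP; rewrite ?mulr0 // => /mnmP e.
  by case/eqP: aa0; apply/ffunP => i; apply/val_inj; have := e i; rewrite !mnmE.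
(* [q] is [P] at a generic upper triangular matrix. Once [q = 0], [P] vanishes on B and hence [p] on
   the orbit, since [\det g != 0]. *)
pose q : {mpoly k[n * n]} :=
  \sum_(a : {ffun 'I_d -> 'I_N0})
    v a *: orbit_monomial f D (fun i => a i) (map_mx (@mpolyC (n * n) k) x) X_.
have qE Z : q.@[coords Z] = P (cproj (@upper_pos n) Z).
  rewrite raddf_sum /=; apply: eq_bigr => a _; rewrite mevalZ -map_orbit_monomial.
  congr (_ * orbit_monomial _ _ _ _ _); last exact: meval_generic.
  by apply/matrixP => i j; rewrite !mxE; exact: mevalC.
suff q0 : q = 0.
  exists p => // _ [g [[gu ug] ->]].
  have := qE g; rewrite q0 meval0 cproj_upper_tri // Punit // => /esym/eqP.
  have dg : \det g != 0 by rewrite -unitfE -unitmxE.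
  by rewrite mulf_eq0 expf_eq0 (negbTE dg) andbF => /eqP.
apply/eqP/negP => /negP q0.
(* Otherwise a curve leaves 1 in the direction c = w + h, up to entries below the diagonal, with [h]
   centralising [x]. At its points (1 + t w)(1 + t h) = 1 + t c + t^2 w h, [P] equals its value at 1
   + t w, which is 0, times a power of det (1 + t h). *)
have [c curve] := curve_nonvanishing (coords 1%:M) q0.
have [h [s [uh hx cE]]] := decomp (vec_mx (\row_i c i)).
pose w := \sum_i s i *: u i.
have uw : upper_tri w.
  by apply/upper_triP/memv_suml => i _; apply/memvZ/upper_triP/uu.
pose C (M : 'M[k]_n) : 'M[{poly k}]_n := map_mx polyC M.
pose L (M : 'M[k]_n) : 'M[{poly k}]_n := 1%:M + 'X *: C M.
have Lt t M : map_mx (horner_eval t) (L M) = 1%:M + t *: M.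
  by rewrite map_mxD map_mx1 map_mxZ horner_map_mxC /= /horner_eval hornerX.
have dLt t M : (\det (L M)).[t] = \det (1%:M + t *: M).
  by rewrite -[LHS]/(horner_eval t _) -det_map_mx Lt.
pose Dl := \det (L w) * \det (L h).
(* The factor [Dl] cancels in the quotient; it only forces 1 + t w and 1 + t h to be invertible at
   the chosen [t]. *)
pose V i := ((c i)%:P + (coords (w *m h) i) *: 'X) * Dl.
have Dl0 : Dl.[0] = 1 by rewrite hornerM !dLt !scale0r !addr0 !det1 mulr1.
have [||t [Dt]] := curve V Dl; last first.
- apply/negP; rewrite negbK.
  pose Z := 1%:M + t *: (vec_mx (\row_i c i) + t *: (w *m h)).
  rewrite (meval_eq (v2 := coords Z)) => [|i].
    have -> : q.@[coords Z] = P ((1%:M + t *: w) *m (1%:M + t *: h)).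
      rewrite qE /Z; congr P; rewrite cprojD cprojZ cprojD cprojZ cE.
      rewrite !cproj_upper_tri; [|exact: upper_triM|exact: upper_tri1].
      rewrite mulmxDl mul1mx mulmxDr mulmx1 -!(scalemxAl, scalemxAr) -/w.
      rewrite !scalerDr -!addrA; congr (_ + _); rewrite addrCA; congr (_ + _).
    move: Dt; rewrite hornerM !dLt mulf_eq0 negb_or -!unitfE -!unitmxE => /andP[wu hu].
    have ghu : (1%:M + t *: w) *m (1%:M + t *: h) \in unitmx by rewrite unitmx_mul wu.
    have -> : P ((1%:M + t *: w) *m (1%:M + t *: h)) =
        \det (1%:M + t *: h) ^+ D * P (1%:M + t *: w).
      rewrite !Punit // det_mulmx exprMn mulrCA mulrA; congr (_ * _).
      apply: meval_eq => i; congr (fun_of_matrix _ _ _).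
      apply: (canLR (mulmxK ghu)); rewrite !mulmxA mulmxKV // -!mulmxA; congr (_ *m _).
      rewrite mulmxDl mulmxDr mul1mx mulmx1; congr (_ + _).
      by rewrite -scalemxAl -scalemxAr hx.
    have -> : 1%:M + t *: w = U [ffun i => t * s i].
      congr (_ + _); rewrite scaler_sumr; apply: eq_bigr => i _.
      by rewrite ffunE scalerA.
    by rewrite PU mulr0.
  rewrite /V hornerM mulrA mulfK // hornerD hornerC hornerZ hornerX.
  rewrite /coords !(linearD, linearZ) /= vec_mxK !mxE; ring.
- by rewrite Dl0 oner_eq0.
- by move=> i; rewrite hornerM Dl0 hornerD hornerC hornerZ hornerX mulr0 addr0 mulr1.
Qed.

End OrbitDimension.

(** * The two-strand normal form *)

Section Word.
Variables (n : nat) (inI : pred nat) (w0 : bool).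

(* Positions labelled [true] and [false] form the two Jordan strands of the
   normal form; [true] is never doubled, and a doubled pair [i, i.+1] with
   [inI i] is either two [false] or a "turn" from [true] to [false]. *)
Fixpoint word (i : nat) : bool := if i is j.+1 then ~~ word j && ~~ inI j else w0.

Definition turn (i : nat) : bool := inI i && word i.

(* Some value >= n if no position of the same strand follows. *)
Definition nxt (i : nat) : nat :=
  (i.+1 + find (fun j => word j == word i) (iota i.+1 n))%N.

Lemma word_true_next i : word i -> word i.+1 = false.
Proof. by move=> /= ->. Qed.

Lemma word_in_next i : inI i -> word i.+1 = false.
Proof. by move=> /= ->; rewrite andbF. Qed.

Lemma nxt_gt i : (i < nxt i)%N.
Proof. exact: leq_addr. Qed.

Lemma nxt_between i j : (i < j < nxt i)%N -> word j = ~~ word i.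
Proof.
case/andP => ij; rewrite -{1}(subnKC ij) ltn_add2l => jf.
have := before_find 0 jf; rewrite nth_iota ?subnKC //; last first.
  by apply: leq_trans jf _; rewrite -[X in (_ <= X)%N](size_iota i.+1 n) find_size.
by case: (word j) (word i) => [] [].
Qed.

Lemma word_nxt i : (nxt i < n)%N -> word (nxt i) = word i.
Proof.
rewrite /nxt => lt; set f := find _ _ in lt *.
have fn : (f < n)%N by apply: leq_ltn_trans lt; rewrite leq_addl.
have hs : has (fun j => word j == word i) (iota i.+1 n) by rewrite has_find size_iota.
by have := nth_find 0 hs; rewrite -/f nth_iota // => /eqP.
Qed.

Lemma nxt_le i j : (i < j)%N -> word i = word j -> (nxt i <= j)%N.
Proof.
move=> ij wij; rewrite leqNgt; apply/negP => jn.
have := @nxt_between i j; rewrite ij jn wij => /(_ isT).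
by case: (word j).
Qed.

Lemma nxtS i : (i.+1 < n)%N -> word i = word i.+1 -> nxt i = i.+1.
Proof. by move=> iN wi; apply/eqP; rewrite eqn_leq nxt_gt nxt_le. Qed.

Lemma nxt_inj i j : (nxt i < n)%N -> nxt i = nxt j -> i = j.
Proof.
move=> lt e; have ltj : (nxt j < n)%N by rewrite -e.
have wij : word i = word j by rewrite -word_nxt // e word_nxt.
have [ij|ij|//] := ltngtP i j.
  by have := nxt_le ij wij; have := nxt_gt j; rewrite e; lia.
by have := nxt_le ij (esym wij); have := nxt_gt i; rewrite e; lia.
Qed.

(** Iterating [nxt] from [i] reaches [j]; [l] is the last position of the strand before [j]. *)
Lemma nxt_surj i j : (i < j < n)%N -> word i = word j ->
  exists l, [/\ (i <= l)%N, nxt l = j & word l = word j].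
Proof.
case/andP => ij jn; have [m] := ubnP (j - i); elim: m i ij => // m IH i ij jm wij.
have := nxt_le ij wij; rewrite leq_eqVlt => /orP[/eqP e|lt]; first by exists i.
have gt := nxt_gt i; have wn := word_nxt (ltn_trans lt jn).
have [|l [nl e wl]] := IH _ lt _ (etrans wn wij); first by lia.
by exists l; split=> //; lia.
Qed.

Lemma big_nxt (R : nmodType) (F : nat -> R) l : (nxt l < n)%N ->
  \sum_(m < n | nxt m == nxt l) F m = F l.
Proof.
move=> lt; have ln : (l < n)%N by apply: ltn_trans (nxt_gt l) lt.
rewrite (big_pred1 (Ordinal ln)) // => m; rewrite -[RHS]val_eqE /=.
by apply/eqP/eqP => [/esym/(nxt_inj lt)|->].
Qed.

Hypothesis inI_lt : forall i, inI i -> (i.+1 < n)%N.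

(** * The normal form and the elimination of matrix units *)

Section NormalForm.
Variables (k : fieldType) (mu : nat -> k).
Hypothesis mu_turn : forall i, ~~ turn i -> mu i = 0.
Local Notation E := (E k n).

(** Thus a strand ends by itself in [strands] when [nxt] leaves the range. *)
Lemma E_out_r i j : (n <= j)%N -> E i j = 0.
Proof.
move=> nj; apply/matrixP => a b; rewrite !mxE.
by case: (b =P j :> nat) => [e|]; rewrite ?andbF //; have := ltn_ord b; lia.
Qed.

Lemma E_ord (i j : 'I_n) : E i j = delta_mx i j.
Proof. by apply/matrixP => a b; rewrite !mxE !val_eqE. Qed.

Lemma mulE i j l m : (j < n)%N -> E i j *m E l m = if j == l then E i m else 0.
Proof.
move=> jn; apply/matrixP => a b; rewrite mxE (bigD1 (Ordinal jn)) //= big1 => [|c cj].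
  rewrite !mxE /= eqxx andbT addr0; case: (j =P l) => [_|_] /=; last by rewrite mulr0 mxE.
  by rewrite mxE /= -natrM mulnb.
rewrite !mxE [X in _ && X]negbTE ?andbF ?mul0r //.
Qed.

Definition strands : 'M[k]_n := \sum_(i < n) E i (nxt i).
Definition glue : 'M[k]_n := \sum_(i < n) mu i *: E i i.+1.
Definition normal_form : 'M[k]_n := strands + glue.

Lemma mulE_normal_form i j : (j < n)%N ->
  E i j *m normal_form = E i (nxt j) + mu j *: E i j.+1.
Proof.
move=> jn; rewrite mulmxDr !mulmx_sumr; congr (_ + _).
  rewrite (bigD1 (Ordinal jn)) //= mulE // eqxx big1 ?addr0 // => l lj.
  by rewrite mulE //; case: eqP => // e; case/eqP: lj; apply/val_inj.
rewrite (bigD1 (Ordinal jn)) //= -scalemxAr mulE // eqxx big1 ?addr0 // => l lj.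
rewrite -scalemxAr mulE //; case: eqP => // e; last by rewrite scaler0.
by case/eqP: lj; apply/val_inj.
Qed.

Lemma mul_normal_form_E i j : (i < n)%N ->
  normal_form *m E i j =
    \sum_(l < n | nxt l == i) E l j + (if i is i'.+1 then mu i' *: E i' j else 0).
Proof.
move=> i_n; rewrite mulmxDl !mulmx_suml; congr (_ + _).
  rewrite [RHS]big_mkcond; apply: eq_bigr => l _.
  have [ln|nl] := ltnP (nxt l) n; first by rewrite mulE.
  by rewrite E_out_r // mul0mx; case: eqP => // e; move: nl; rewrite e leqNgt i_n.
case: i i_n => [|i] i_n.
  rewrite big1 // => l _; rewrite -scalemxAl.
  have [ln|nl] := ltnP l.+1 n; first by rewrite mulE // scaler0.
  by rewrite E_out_r // mul0mx scaler0.
rewrite (bigD1 (Ordinal (ltnW i_n))) //= -scalemxAl mulE // eqxx big1 ?addr0 // => l li.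
rewrite -scalemxAl; have [ln|nl] := ltnP l.+1 n; last by rewrite E_out_r // mul0mx scaler0.
rewrite mulE //; case: eqP => [[e]|]; last by rewrite scaler0.
by case/eqP: li; apply/val_inj.
Qed.

Definition turn_pos : pred ('I_n * 'I_n) := fun p => turn p.1 && (p.2 == p.1.+1 :> nat).

Let S := (tangent normal_form + coordsp k turn_pos)%VS.

Lemma E_turn_mem i : turn i -> E i i.+1 \in S.
Proof.
move=> ti; rewrite -[E _ _]add0r memv_add ?mem0v //; apply/coordspP => a b nt; rewrite mxE.
case: andP => // -[/eqP ea /eqP eb]; case/negP: nt.
by rewrite /turn_pos /= ea eb ti eqxx.
Qed.

(** This is the bracket of [E i j] with the normal form. The elimination below starts from these
    relations and the matrix units at turns. *)
Lemma relation_mem i j : (i <= j < n)%N ->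
  E i (nxt j) + mu j *: E i j.+1
  - (\sum_(l < n | nxt l == i) E l j + (if i is i'.+1 then mu i' *: E i' j else 0)) \in S.
Proof.
case/andP => ij jn; rewrite -mulE_normal_form // -mul_normal_form_E ?(leq_ltn_trans ij) //.
rewrite -[X in X \in _]addr0 memv_add ?mem0v //; apply/tangentP; exists (E i j) => // a b ba.
rewrite mxE; case: andP => // -[/eqP ea /eqP eb]; move: ba; rewrite ea eb; lia.
Qed.

Lemma E_mem_push i l :
  (i <= l < n)%N -> mu l *: E i l.+1 \in S ->
  (forall m, nxt m = i -> E m l \in S) ->
  (forall m, i = m.+1 -> turn m -> E m l \in S) -> E i (nxt l) \in S.
Proof.
move=> il S1 S2 S3; have := relation_mem il.
have S2' : \sum_(m < n | nxt m == i) E m l \in S by apply: memv_suml => m /eqP/S2.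
have S3' : (if i is i'.+1 then mu i' *: E i' l else 0) \in S.
  case: i {il S1 S2 S2'} S3 => [|i] S3; first exact: mem0v.
  have [ti|nt] := boolP (turn i); first by rewrite memvZ // S3.
  by rewrite mu_turn // scale0r mem0v.
by rewrite rpredBr; [rewrite rpredDr | exact: memvD].
Qed.

(** As [l] carries [false], [mu l] is 0; as [a] carries [true], no turn precedes it. What remains is
    the unit in the previous row of the strand of [a], covered by induction. *)
Lemma E_true_false_mem a b : word a -> ~~ word b -> (a.+1 < b < n)%N -> E a b \in S.
Proof.
elim/ltn_ind: a b => a IH b wa wb ab; have wa1 := word_true_next wa.
have [|l [al nl wl]] := nxt_surj ab; first by rewrite wa1 (negbTE wb).
have lb := nxt_gt l; rewrite -nl; apply: E_mem_push; first by lia.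
- by rewrite mu_turn ?scale0r ?mem0v // /turn wl (negbTE wb) andbF.
- move=> m nm; have ma := nxt_gt m; apply: IH; rewrite ?wl //; try by lia.
  by rewrite -word_nxt nm //; lia.
- by move=> m e /andP[_ wm]; move: wa; rewrite e word_true_next.
Qed.

(** Here a turn may precede [a]; it leaves a unit from [true] to [false], which is settled above or
    lies in W. *)
Lemma E_false_false_mem a b : ~~ word a -> ~~ word b -> (a < b < n)%N -> E a b \in S.
Proof.
elim/ltn_ind: a b => a IH b wa wb ab.
have [|l [al nl wl]] := nxt_surj ab; first by rewrite (negbTE wa) (negbTE wb).
have lb := nxt_gt l; rewrite -nl; apply: E_mem_push; first by lia.
- by rewrite mu_turn ?scale0r ?mem0v // /turn wl (negbTE wb) andbF.
- move=> m nm; have ma := nxt_gt m; apply: IH; rewrite ?wl //; try by lia.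
  by rewrite -word_nxt nm //; lia.
- move=> m e tm; have [el|nel] := eqVneq a l; first by rewrite -el e E_turn_mem.
  have /andP[_ wm] := tm; apply: E_true_false_mem => //; first by rewrite wl.
  by lia.
Qed.

Lemma E_true_true_mem a b : word a -> word b -> (a < b < n)%N -> E a b \in S.
Proof.
elim/ltn_ind: a b => a IH b wa wb ab.
have [|l [al nl wl]] := nxt_surj ab; first by rewrite wa wb.
have lb := nxt_gt l; rewrite -nl; apply: E_mem_push; first by lia.
- have [tl|ntl] := boolP (turn l); last by rewrite mu_turn ?scale0r ?mem0v.
  apply: memvZ; have [->|nel] := eqVneq a l; first exact: E_turn_mem.
  by apply: E_true_false_mem => //; rewrite ?word_true_next ?wl //; lia.
- move=> m nm; have ma := nxt_gt m; apply: IH; rewrite ?wl //; try by lia.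
  by rewrite -word_nxt nm //; lia.
- by move=> m e /andP[_ wm]; move: wa; rewrite e word_true_next.
Qed.

(** This case runs upwards from the last rows: the relation at [(nxt a, b)] is solved for its third
    term [E a b], and the remaining units are of kinds already treated or lie in the lower row
    [nxt a]. *)
Lemma E_false_true_mem a b : ~~ word a -> word b -> (a.+1 < b < n)%N -> E a b \in S.
Proof.
have [m] := ubnP (n - a); elim: m a b => // m IH a b am wa wb ab.
(* No two consecutive positions carry [true], so [nxt a] is at most [a.+2]; and [b], which carries
   [true], is not [a.+2] if [a.+1] does. *)
have nab : (nxt a < b)%N.
  have [wa1|wa1] := boolP (word a.+1).
    have wa2 := word_true_next wa1; have : a.+2 != b by apply: contraTneq wb => <-; rewrite wa2.
    by have := @nxt_le a a.+2; rewrite wa2 (negbTE wa) => /(_ _ erefl); lia.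
  by have := @nxt_le a a.+1; rewrite (negbTE wa1) (negbTE wa) => /(_ _ erefl); lia.
have na := nxt_gt a; have nb := nxt_gt b.
have wna : word (nxt a) = false by rewrite word_nxt; [exact: negbTE | lia].
have [c ec] : exists c, nxt a = c.+1 by exists (nxt a).-1; rewrite prednK //; lia.
have nan : (nxt a < n)%N by lia.
have sumE : \sum_(l < n | nxt l == c.+1) E l b = E a b.
  by rewrite -ec; exact: (big_nxt (fun l => E l b)).
rewrite {}ec in na nab wna nan; have := @relation_mem c.+1 b; rewrite sumE.
set A := E _ _ + _; have AS : A \in S.
  apply: memvD.
    have [nbn|] := ltnP (nxt b) n; last by move/E_out_r => ->; exact: mem0v.
    by apply: IH; rewrite ?wna ?word_nxt //; lia.
  have [tb|ntb] := boolP (turn b); last by rewrite mu_turn ?scale0r ?mem0v.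
  apply/memvZ/E_false_false_mem; rewrite ?wna ?word_true_next //.
  by have /andP[/inI_lt] := tb; lia.
rewrite rpredBl // rpredDr; first by apply; lia.
have [/andP[_ wc]|nc] := boolP (turn c); last by rewrite mu_turn ?scale0r ?mem0v.
by apply/memvZ/E_true_true_mem => //; lia.
Qed.

Lemma E_mem a b : (a < b < n)%N -> (a.+1 < b)%N || inI a -> E a b \in S.
Proof.
move=> ab; have [abs _|] := boolP (a.+1 < b)%N; last first.
  move=> /negbTE nab /= Ia; have -> : b = a.+1 by lia.
  have [wa|wa] := boolP (word a); first by rewrite E_turn_mem // /turn Ia.
  by apply: E_false_false_mem; rewrite ?word_in_next //; have := inI_lt Ia; lia.
case: (boolP (word a)) => wa; case: (boolP (word b)) => wb.
- exact: E_true_true_mem.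
- by apply: E_true_false_mem; rewrite // abs; lia.
- by apply: E_false_true_mem; rewrite // abs; lia.
- exact: E_false_false_mem.
Qed.

(** Extended by 0 because indices such as [nxt r] and [r.+1] may leave the range. *)
Definition entry (X : 'M[k]_n) (i j : nat) : k :=
  if insub i is Some a then if insub j is Some b then X a b else 0 else 0.

Lemma entry_ord X (a b : 'I_n) : entry X a b = X a b.
Proof. by rewrite /entry !valK. Qed.

Lemma entry_upper X i j : upper_tri X -> (j < i)%N -> entry X i j = 0.
Proof.
move=> uX ji; rewrite /entry; case: insubP => // a _ ea; case: insubP => // b _ eb.
by rewrite uX // ea eb.
Qed.

Lemma sum_entry (X : 'M[k]_n) (i : nat) (c : 'I_n) :
  \sum_(m < n) (i == m :> nat)%:R * X m c = entry X i c.
Proof.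
rewrite /entry valK; case: insubP => [a _ <-|ni].
  rewrite (bigD1 a) //= eqxx mul1r big1 ?addr0 // => m ma.
  by rewrite eq_sym val_eqE (negbTE ma) mul0r.
rewrite big1 // => m _; case: eqP => [e|_]; last by rewrite mul0r.
by case/negP: ni; rewrite e.
Qed.

Lemma glueE (a b : 'I_n) : glue a b = mu a * (a.+1 == b :> nat)%:R.
Proof.
rewrite summxE (bigD1 a) //= !mxE eqxx big1 ?addr0 => [|i ia]; first by rewrite eq_sym.
by rewrite !mxE eq_sym val_eqE (negbTE ia) mulr0.
Qed.

Lemma normal_formE (a b : 'I_n) :
  normal_form a b = (nxt a == b)%:R + mu a * (a.+1 == b :> nat)%:R.
Proof.
rewrite mxE glueE; congr (_ + _).
rewrite summxE (bigD1 a) //= !mxE eqxx big1 ?addr0 => [|i ia]; first by rewrite eq_sym.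
by rewrite !mxE eq_sym val_eqE (negbTE ia).
Qed.

Lemma lie_br_normal_formE (X : 'M[k]_n) (r c : 'I_n) : lie_br X normal_form r c =
  \sum_(m < n | nxt m == c) entry X r m
  + (if c : nat is c'.+1 then mu c' * entry X r c' else 0)
  - (entry X (nxt r) c + mu r * entry X r.+1 c).
Proof.
rewrite !mxE; congr (_ - _).
  under eq_bigr do rewrite normal_formE mulrDr.
  rewrite big_split /=; congr (_ + _).
    rewrite [RHS]big_mkcond; apply: eq_bigr => m _; rewrite entry_ord.
    by case: eqP; rewrite ?mulr1 ?mulr0.
  case: c => [[|c] cn] /=; first by rewrite big1 // => m _; rewrite !mulr0.
  rewrite (bigD1 (Ordinal (ltnW cn))) //= eqxx mulr1 mulrC.
  rewrite -(entry_ord X r (Ordinal (ltnW cn))) big1 ?addr0 // => m mc.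
  rewrite eqSS (negbTE (_ : m != c :> nat)) ?mulr0 //.
by under eq_bigr do rewrite normal_formE mulrDl -mulrA; rewrite big_split -big_distrr /= !sum_entry.
Qed.

(** * Matrices X in b whose bracket with the normal form lies in W *)

Section TangentTurn.
Hypothesis turn_doubled : forall t, turn t -> exists i, [/\ (i < t)%N, inI i & ~~ word i].
Variable X : 'M[k]_n.
Hypotheses (uX : upper_tri X) (XW : lie_br X normal_form \in coordsp k turn_pos).
Local Notation e := (entry X).

Lemma mu_false i : ~~ word i -> mu i = 0.
Proof. by move=> wi; rewrite mu_turn // /turn (negbTE wi) andbF. Qed.

Lemma nxtSS i : (i.+2 < n)%N -> word i.+1 = ~~ word i -> word i = word i.+2 -> nxt i = i.+2.
Proof.
move=> iN w1 w2; have gt := nxt_gt i; have le := nxt_le (leqnSn i.+1) w2.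
have [|//|] := ltngtP (nxt i) i.+2; last by [].
  move=> lt; have e1 : nxt i = i.+1 by lia.
  by have := @word_nxt i; rewrite e1 w1 ltnW // => /(_ isT); case: word.
by lia.
Qed.

Lemma entry_relation r c : (r < n)%N -> (c < n)%N -> ~~ (turn r && (c == r.+1)) ->
  \sum_(m < n | nxt m == c) e r m + (if c is c'.+1 then mu c' * e r c' else 0)
  = e (nxt r) c + mu r * e r.+1 c.
Proof.
move=> rn cn nt; have := coordspP _ _ XW (Ordinal rn) (Ordinal cn).
by rewrite /turn_pos lie_br_normal_formE /= => /(_ nt)/eqP; rewrite subr_eq0 => /eqP.
Qed.

(** Relations carry the entry back two positions at a time while the letters alternate. At a doubled
    [false] it becomes a sum of entries below the diagonal, hence 0; the position [i] provides such
    a pair. *)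
Lemma entry_before_true m : word m.+1 -> (m.+1 < n)%N ->
  (exists i, [/\ (i <= m)%N, inI i & ~~ word i]) -> e m m.+1 = 0.
Proof.
elim/ltn_ind: m => m IH w1 mn [i [im Ii wi]].
have /andP[wm nIm] : ~~ word m && ~~ inI m by [].
have ltim : (i < m)%N by rewrite ltn_neqAle im andbT; apply: contraNneq nIm => <-.
case: m => [|m] // in IH w1 mn im wm nIm ltim *.
have [wm'|wm'] := boolP (word m); last first.
  have nt : ~~ (turn m && (m.+2 == m.+1)) by rewrite /turn (negbTE wm') andbF.
  have := entry_relation (ltnW (ltnW mn)) mn nt; rewrite !mu_false // !mul0r !addr0.
  rewrite nxtS ?(negbTE wm) ?(negbTE wm') //; last exact: ltnW.
  move=> <-; rewrite big1 // => l /eqP nl; apply: entry_upper => //.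
  have wl : word l by rewrite -word_nxt nl.
  have := nxt_gt l; rewrite nl => ltl.
  have : l != m.+1 :> nat by apply: contraTneq wl => ->.
  have : l != m :> nat by apply: contraTneq wl => ->.
  by lia.
have lt' : (i < m)%N by rewrite ltn_neqAle -ltnS ltim andbT; apply: contraNneq wi => ->.
case: m => [|m] // in IH w1 mn im wm nIm ltim wm' lt' *.
have wm2 : ~~ word m by move: wm' => /= /andP[].
have nt : ~~ (turn m && (m.+3 == m.+1)) by rewrite /turn (negbTE wm2) andbF.
have := entry_relation (ltnW (ltnW (ltnW mn))) mn nt; rewrite !mu_false // !mul0r !addr0.
rewrite (@nxtSS m) ?wm' ?(negbTE wm) ?(negbTE wm2) //; last exact: ltnW.
move=> <-; have nx : nxt m.+1 = m.+3 by rewrite nxtSS ?wm' ?w1 ?(negbTE wm).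
rewrite -[X in \sum_(_ < n | _ == X) _]nx (big_nxt (fun l => e m l)) ?nx //.
by apply: IH => //; [lia|exists i].
Qed.

(** The relation in row t - 1 and column [nxt t] identifies this entry with the one at (t - 1, t),
    which is 0 by [entry_before_true]. *)
Lemma entry_after_turn t : turn t -> (nxt t < n)%N -> e t.+1 (nxt t) = 0.
Proof.
move=> tt ntn; have [i [it Ii wi]] := turn_doubled tt; have /andP[It wt] := tt.
case: t => // t in tt ntn it It wt *.
have wt' : ~~ word t by move: wt => /= /andP[].
have gt := nxt_gt t.+1; have wn := word_nxt ntn.
have nt : ~~ (turn t && (nxt t.+1 == t.+1)) by rewrite /turn (negbTE wt') andbF.
have tn := inI_lt It.
have := entry_relation (ltnW (ltnW tn)) ntn nt; rewrite (big_nxt (fun l => e t l)) //.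
rewrite (@nxtSS t) ?wt ?(negbTE wt') ?(word_true_next wt) //.
rewrite (mu_false wt') mul0r addr0 => <-.
rewrite (entry_before_true wt (ltnW tn)); last by exists i.
case en : (nxt t.+1) wn => [|c] wn; rewrite ?addr0 //.
have [wc|wc] := boolP (word c); last by rewrite mu_false // mul0r addr0.
by move: wn; rewrite (word_true_next wc) wt.
Qed.

(** The relation at [(i, nxt i)] compares the two diagonal entries; where [mu] is not 0, its glue
    terms vanish by [entry_after_turn] and [entry_before_true]. *)
Lemma entry_diag_nxt i : (nxt i < n)%N -> e i i = e (nxt i) (nxt i).
Proof.
move=> nin; have gt := nxt_gt i; have wn := word_nxt nin.
have i_n : (i < n)%N by apply: ltn_trans nin.
have nt : ~~ (turn i && (nxt i == i.+1)).
  apply/negP => /andP[/andP[_ wi] /eqP en]; move: wn.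
  by rewrite en word_true_next ?wi.
have := entry_relation i_n nin nt; rewrite (big_nxt (fun l => e i l)) //.
have -> : mu i * e i.+1 (nxt i) = 0.
  have [ti|ti] := boolP (turn i); last by rewrite mu_turn // mul0r.
  by rewrite entry_after_turn // mulr0.
rewrite addr0 => <-; case en : (nxt i) => [|c]; first by rewrite addr0.
have [tc|tc] := boolP (turn c); last by rewrite mu_turn // mul0r addr0.
have /andP[Ic wc] := tc; have wc1 := word_true_next wc; rewrite en wc1 in wn.
have ic : (i < c)%N.
  by rewrite ltn_neqAle -ltnS -en gt andbT; apply: contraTneq wc => <-; rewrite -wn.
case: c => // c in en tc Ic wc wc1 wn ic *.
have wc' : ~~ word c by move: wc => /= /andP[].
have -> : i = c.
  apply/eqP; rewrite eqn_leq -ltnS ic /= leqNgt; apply/negP => lt.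
  by have := @nxt_between i c; rewrite lt en leqnSn -wn (negbTE wc') => /(_ isT).
have [j [jc Ij wj]] := turn_doubled tc.
by rewrite entry_before_true ?mulr0 ?addr0 //; [have := inI_lt Ic; lia|exists j].
Qed.

Lemma entry_diag_word i j : word i = word j -> (i < n)%N -> (j < n)%N -> e i i = e j j.
Proof.
wlog ij : i j / (i < j)%N => [sym wij i_n jn|].
  by have [ij|ji|->//] := ltngtP i j; [exact: sym|apply/esym/sym].
move=> + _; elim/ltn_ind: j ij => j IH ij wij jn.
have [|l [il nl wl]] := @nxt_surj i j _ wij; first by rewrite ij.
have lj : (l < j)%N by rewrite -nl nxt_gt.
have <- : e l l = e j j by rewrite -nl entry_diag_nxt ?nl.
have [->//|nil] := eqVneq i l.
by apply: IH => //; [rewrite ltn_neqAle nil|rewrite wl|exact: ltn_trans jn].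
Qed.

(** [t] and [t.+1] carry different letters, so the terms coming from the strands are entries of [X]
    below the diagonal; only the glue contributes. *)
Lemma lie_br_normal_form_turn t : turn t ->
  entry (lie_br X normal_form) t t.+1 = mu t * (e t t - e t.+1 t.+1).
Proof.
move=> tt; have /andP[It wt] := tt; have tn := inI_lt It; have w1 := word_true_next wt.
rewrite (entry_ord _ (Ordinal (ltnW tn)) (Ordinal tn)) lie_br_normal_formE /=.
rewrite big1 => [|l /eqP nl]; last first.
  apply: entry_upper => //; have := nxt_gt l; rewrite nl ltnS leq_eqVlt => /orP[/eqP el|//].
  by move: (@word_nxt l); rewrite nl w1 el wt => /(_ tn).
rewrite (@entry_upper X (nxt t)) ?add0r ?mulrBr //.
have := nxt_gt t; rewrite leq_eqVlt => /orP[/eqP el|//].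
by move: (@word_nxt t); rewrite -el w1 wt => /(_ tn).
Qed.

(** The diagonal of [X] is constant on each strand, so the difference of the two constants is a
    common factor for all turns. *)
Lemma lie_br_turn_line : exists a, lie_br X normal_form = a *: glue.
Proof.
pose Y := lie_br X normal_form; have Y0 := coordspP _ _ XW.
have [a Ya] : exists a, forall t, turn t -> entry Y t t.+1 = a * mu t.
  have [/existsP[[t t_lt] /= tt]|/existsPn none] := boolP [exists t : 'I_n, turn t].
    exists (e t t - e t.+1 t.+1) => s ts.
    have /andP[It wt] := tt; have /andP[Is ws] := ts.
    have tn := inI_lt It; have sn := inI_lt Is.
    rewrite lie_br_normal_form_turn // mulrC (@entry_diag_word s t) ?wt ?(ltnW sn) ?(ltnW tn) //.
    by rewrite (@entry_diag_word s.+1 t.+1) // !word_true_next.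
  exists 0 => t tt; have /andP[/inI_lt tn _] := tt.
  by case/negP: (none (Ordinal (ltnW tn))).
exists a; apply/matrixP => i j; rewrite [RHS]mxE.
rewrite glueE; have [ij|nij] := boolP (turn_pos (i, j)).
  have /andP[/= ti /eqP ej] := ij.
  by rewrite -(entry_ord (lie_br _ _)) ej Ya // eqxx mulr1.
rewrite Y0 //; move: nij; rewrite /turn_pos negb_and /= eq_sym => /orP[ni|/negbTE->].
  by rewrite mu_turn // mul0r mulr0.
by rewrite !mulr0.
Qed.

End TangentTurn.

End NormalForm.
End Word.

(** * Even gaps and turns *)

Section Counting.
Variables (inI : pred nat) (w0 : bool).
Local Notation word := (word inI w0).

Definition starts_false := forall i, inI i -> (forall j, (j < i)%N -> ~~ inI j) -> ~~ word i.

Lemma word_alternate i m : (forall j, (i <= j < i + m)%N -> ~~ inI j) ->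
  word (i + m) = word i (+) odd m.
Proof.
elim: m => [|m IH] no; first by rewrite addn0 addbF.
rewrite addnS /= IH => [|j jm]; last by apply: no; lia.
by rewrite no ?andbT ?addbN //; lia.
Qed.

(** After a simple position the letter is [false] and then alternates up to the next simple one,
    which thus carries [true] exactly when the gap is even. *)
Lemma count_even_gaps i a m : inI i -> (i < a)%N ->
  (forall j, (i < j < a)%N -> ~~ inI j) ->
  count (fun d => ~~ odd d) (pairmap (fun b c => c - b)%N i [seq j <- iota a m | inI j])
  = count word [seq j <- iota a m | inI j].
Proof.
elim: m a i => //= m IH a i Ii ia no.
have [Ia|nIa] := boolP (inI a) => /=; last first.
  by apply: IH => //; [lia|move=> j; case: (eqVneq j a) => [->//|ja] ?; apply: no; lia].
congr (_ + _)%N; last by apply: IH => // j; lia.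
have -> : a = (i.+1 + (a - i.+1))%N by lia.
rewrite word_alternate => [|j jm]; last by apply: no; lia.
rewrite word_in_next //; have -> : (i.+1 + (a - i.+1) - i)%N = (a - i.+1).+1 by lia.
by rewrite /= negbK.
Qed.

Lemma count_even_gaps_head a m : starts_false -> (forall j, (j < a)%N -> ~~ inI j) ->
  match [seq j <- iota a m | inI j] with
  | [::] => 0
  | i :: s => count (fun d => ~~ odd d) (pairmap (fun b c => c - b) i s)
  end%N = count word [seq j <- iota a m | inI j].
Proof.
move=> sf; elim: m a => //= m IH a no.
have [Ia|nIa] := boolP (inI a) => /=.
  by rewrite (negbTE (sf _ Ia no)) count_even_gaps // => j; lia.
by apply: IH => j; rewrite ltnS leq_eqVlt => /orP[/eqP->//|]; exact: no.
Qed.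

End Counting.

Lemma exists_starts_false (inI : pred nat) (m : nat) : (forall i, inI i -> (i < m)%N) ->
  exists w0, starts_false inI w0.
Proof.
move=> lt; have [/hasP ex|no] := boolP (has inI (iota 0 m)); last first.
  exists false => i Ii; case/hasP: no; exists i => //.
  by rewrite mem_iota add0n lt.
have {}ex : exists i, inI i by case: ex => i; exists i.
(* Letters alternate from 0 to the first simple position [i], so starting with [odd i] gives [false]
   at [i]. *)
case: (ex_minnP ex) => i Ii imin; exists (odd i) => j Ij jmin.
have -> : j = i.
  apply/eqP; rewrite eqn_leq imin // andbT leqNgt.
  by apply: contraL Ii => /jmin.
rewrite -[i in word _ _ i]add0n word_alternate /= ?addbb // => l li.
by apply: contraL li => /imin; rewrite -leqNgt.
Qed.

Lemma turn_doubled (inI : pred nat) (w0 : bool) : starts_false inI w0 ->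
  forall t, turn inI w0 t -> exists i, [/\ (i < t)%N, inI i & ~~ word inI w0 i].
Proof.
move=> sf t /andP[It wt]; have ex : exists i, inI i by exists t.
case: (ex_minnP ex) => i Ii imin.
have wi : ~~ word inI w0 i.
  by apply: sf => // j; apply: contraL => /imin; rewrite -leqNgt.
exists i; split=> //; rewrite ltn_neqAle imin // andbT.
by apply: contraNneq wi => ->.
Qed.

Lemma card_turn_pos (n : nat) (inI : pred nat) (w0 : bool) :
  (forall i, inI i -> (i.+1 < n)%N) ->
  #|@turn_pos n inI w0| = count (word inI w0) [seq i <- iota 0 n.-1 | inI i].
Proof.
move=> lt; rewrite count_filter.
transitivity (count (turn inI w0) (iota 0 n)); last first.
  case: n lt => // n lt; rewrite -[n.+1]addn1 iotaD count_cat /= /turn.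
  have -> : inI n = false by apply/negP => /lt; rewrite ltnn.
  by rewrite /= !addn0 addn1; apply: eq_count => i /=; rewrite andbC.
rewrite -sum1_count -sum1_card.
rewrite (eq_bigl (fun p : 'I_n * 'I_n => turn inI w0 p.1 && (p.2 == p.1.+1 :> nat))) //.
rewrite -(pair_big_dep (fun a : 'I_n => turn inI w0 a)
  (fun a b : 'I_n => b == a.+1 :> nat) (fun _ _ => 1%N)) /=.
have -> : iota 0 n = index_iota 0 n by rewrite /index_iota subn0.
rewrite big_mkord; apply: eq_bigr => a /andP[/lt an _].
by rewrite (big_pred1 (Ordinal an)).
Qed.

(** * Generic matrices with prescribed support *)

Section GenericMatrix.
Variables (k : closedFieldType) (n d : nat) (f : 'I_d -> 'I_n * 'I_n).

Definition generic_mx : 'M[{mpoly k[d]}]_n :=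
  \matrix_(a, b) \sum_j 'X_j *+ (f j == (a, b)).

Definition coord_mx (v : 'I_d -> k) : 'M[k]_n := \matrix_(a, b) \sum_j v j *+ (f j == (a, b)).

Lemma meval_generic_mx v : map_mx (meval v) generic_mx = coord_mx v.
Proof.
apply/matrixP => a b; rewrite !mxE raddf_sum /=; apply: eq_bigr => j _.
by rewrite mevalMn mevalXU.
Qed.

Lemma coord_mxE v i : injective f -> coord_mx v (f i).1 (f i).2 = v i.
Proof.
move=> fI; rewrite mxE (bigD1 i) //= -surjective_pairing eqxx big1 ?addr0 // => j ji.
by rewrite (inj_eq fI) (negbTE ji).
Qed.

Lemma coord_mx_mem v (P : pred ('I_n * 'I_n)) :
  (forall i, P (f i)) -> coord_mx v \in coordsp k P.
Proof.
move=> Pf; apply/coordspP => a b nP; rewrite mxE big1 // => j _.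
by case: eqP => // e; move: (Pf j); rewrite e (negbTE nP).
Qed.

Lemma coord_mxK (P : pred ('I_n * 'I_n)) (Y : 'M[k]_n) : injective f ->
  (forall p, P p -> exists i, f i = p) -> Y \in coordsp k P ->
  coord_mx (fun i => Y (f i).1 (f i).2) = Y.
Proof.
move=> fI fP /coordspP Y0; apply/matrixP => a b.
have [/fP[i fi]|/Y0 Yab] := boolP (P (a, b)).
  by have := coord_mxE (fun i => Y (f i).1 (f i).2) i fI; rewrite fi.
rewrite mxE big1 // => j _; case: eqP => // ->; exact: Yab.
Qed.

End GenericMatrix.

(** * Structure of the ideal *)

Lemma coordsp_subv (k : fieldType) (n : nat) (P : pred ('I_n * 'I_n)) (V : {vspace 'M[k]_n}) :
  (forall a b, P (a, b) -> E k n a b \in V) -> (coordsp k P <= V)%VS.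
Proof.
move=> PV; apply/subvP => Y /coordspP Y0; rewrite [Y]matrix_sum_delta.
apply: memv_suml => a _; apply: memv_suml => b _.
have [Pab|nP] := boolP (P (a, b)); last by rewrite Y0 // scale0r mem0v.
by rewrite memvZ // -E_ord PV.
Qed.

Section Ideal.
Variables (k : closedFieldType) (n : nat) (N : {vspace 'M[k]_n}).
Hypotheses (idealN : b_ideal N) (u'N : contains_u' N) (Nu : inside_u N).
Local Notation E := (E k n).

(** The bound matters: out of range, [E i i.+1] is 0 and would lie in [N]. *)
Definition simple_in (i : nat) : bool := (i.+1 < n)%N && (E i i.+1 \in N).

Lemma simple_in_lt i : simple_in i -> (i.+1 < n)%N.
Proof. by case/andP. Qed.

Definition ideal_pos : pred ('I_n * 'I_n) :=
  fun p => (p.1 < p.2)%N && ((p.1.+1 < p.2)%N || simple_in p.1).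

Lemma E_strict_upper i j : (i < j)%N -> strict_upper (E i j).
Proof.
move=> ij r c cr; rewrite mxE; case: andP => // -[/eqP er /eqP ec]; move: cr.
by rewrite er ec leqNgt ij.
Qed.

Lemma E_far_mem i j : (i.+1 < j < n)%N -> E i j \in N.
Proof.
case/andP => ij jn.
have <- : lie_br (E i i.+1) (E i.+1 j) = E i j; last first.
  by apply: u'N; apply: E_strict_upper.
by rewrite /lie_br !mulE //; [rewrite eqxx; case: eqP => [e|_]; [lia|rewrite subr0]|lia].
Qed.

Lemma lie_br_diag (i : 'I_n) (Y : 'M[k]_n) r c :
  lie_br (E i i) Y r c = ((r == i)%:R - (c == i)%:R) * Y r c.
Proof.
rewrite E_ord !mxE (bigD1 i) //= [X in _ - X](bigD1 i) //= !mxE !eqxx andbT.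
rewrite !big1 ?addr0 => [|j ji|j ji].
- rewrite mulrBl; congr (_ - _).
    by case: eqP => [->|_]; rewrite ?mul0r.
  by case: eqP => [->|_]; rewrite ?mulr1 ?mul1r ?mulr0 ?mul0r.
- by rewrite !mxE (negbTE ji) mulr0.
- by rewrite !mxE (negbTE ji) andbF mul0r.
Qed.

(* Bracketing twice with diagonal matrix units isolates one superdiagonal entry modulo u'. *)
Lemma ideal_coordsp : N = coordsp k ideal_pos.
Proof.
apply/eqP; rewrite eqEsubv; apply/andP; split; last first.
  apply: coordsp_subv => a b /andP[/= ab /orP[abs|/andP[an]]].
    by apply: E_far_mem; rewrite abs ltn_ord.
  have [abs|nab] := boolP (a.+1 < b)%N; first by move=> _; apply: E_far_mem; rewrite abs ltn_ord.
  by have -> : b = a.+1 :> nat by lia.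
apply/subvP => Y YN; apply/coordspP => a b; rewrite /ideal_pos /= negb_and -leqNgt.
case/orP => [ba|]; first exact: (Nu YN).
rewrite negb_or => /andP[nab nI]; have [ba|ab] := leqP b a; first exact: (Nu YN).
have eb : b = a.+1 :> nat by lia.
have diag (i : 'I_n) : upper_tri (E i i).
  by move=> r c cr; rewrite mxE; case: andP => // -[/eqP er /eqP ec]; move: cr; lia.
pose Z := lie_br (E b b) (lie_br (E a a) Y).
have ZN : Z \in N by apply/idealN/idealN.
pose far : pred ('I_n * 'I_n) := fun p => (p.1.+1 < p.2)%N.
(* The two brackets multiply the entry at [(a, b)] by -1, whence the sign of the correction, and
   kill every other entry of the superdiagonal. *)
have Zfar : Z + Y a b *: E a b \in N.
  have /subvP : (coordsp k far <= N)%VS.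
    by apply: coordsp_subv => r c rc; apply: E_far_mem; rewrite ltn_ord andbT.
  apply; apply/coordspP => r c; rewrite /far /= -leqNgt => rc.
  rewrite mxE !lie_br_diag [X in _ + X]mxE E_ord mxE.
  have [cr|rc'] := leqP c r.
    rewrite (Nu YN cr) !mulr0 add0r; case: eqP => [er|]; rewrite ?mulr0 //.
    by case: eqP => [ec|]; rewrite ?mulr0 //; move: cr; rewrite er ec; lia.
  have ec : c = r.+1 :> nat by lia.
  have [er|nr] := eqVneq r a.
    have -> : c = b by apply: val_inj; rewrite /= ec er eb.
    rewrite er !eqxx; have /negbTE-> : a != b by rewrite -val_eqE /=; lia.
    have /negbTE-> : b != a by rewrite -val_eqE /=; lia.
    by rewrite subr0 mul1r sub0r mulN1r mulr1 addNr.
  have /negbTE-> : c != b.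
    by apply: contra nr => /eqP ecb; apply/eqP/val_inj; move: ec; rewrite ecb eb => -[].
  rewrite mulr0 addr0; case: (eqVneq r b) => [erb|_]; last by rewrite subrr mul0r.
  have /negbTE-> : c != a by rewrite -val_eqE /= ec erb; lia.
  by rewrite subrr mul0r mulr0.
apply/eqP; apply: contraR nI => Yab; rewrite /simple_in -eb ltn_ord /=.
rewrite -[E _ _](scalerK Yab) memvZ //.
by rewrite -[_ *: _](addKr Z) memvD ?memvN.
Qed.

Lemma ideal_memP (Y : 'M[k]_n) :
  reflect (forall a b, ~~ ideal_pos (a, b) -> Y a b = 0) (Y \in N).
Proof. by rewrite {1}ideal_coordsp; exact: coordspP. Qed.

(** Conjugation by B moves entries only up and to the right, and the positions of the ideal are
    closed under such moves. *)
Lemma conj_ideal_mem g x : in_borel g -> x \in N -> g *m x *m invmx g \in N.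
Proof.
move=> bg; have uh := upper_tri_inv bg; have [_ ug] := bg.
move=> /ideal_memP x0; apply/ideal_memP => r c nrc.
rewrite mxE big1 // => b _; have [bc|cb] := leqP b c; last by rewrite uh // mulr0.
rewrite mxE big1 ?mul0r // => a _; have [ra|ar] := leqP r a; last by rewrite ug // mul0r.
rewrite x0 ?mulr0 //; apply: contra nrc; rewrite /ideal_pos /=.
case/andP => ab abI; have [era|nra] := eqVneq r a; first by rewrite era in ra *; lia.
have lra : (r < a)%N by rewrite ltn_neqAle ra andbT.
by rewrite (_ : r.+1 < c)%N ?andbT; lia.
Qed.

End Ideal.

Section Conjugation.
Variables (k : fieldType) (n : nat).

(** [X, g x g^-1] = g [g^-1 X g, x] g^-1, and g^-1 X g is again upper triangular. *)
Lemma dim_tangent_conj (g x : 'M[k]_n) : in_borel g ->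
  (\dim (tangent (g *m x *m invmx g)) <= \dim (tangent x))%N.
Proof.
move=> bg; have [gu ug] := bg; have uh := upper_tri_inv bg.
pose cj (Y : 'M[k]_n) := mulmxr (invmx g) (mulmx g Y).
have cjE Y : cj Y = g *m Y *m invmx g by [].
have cj_lin : linear cj by move=> a X Y; rewrite !cjE mulmxDr mulmxDl -scalemxAr -scalemxAl.
pose L : {linear 'M[k]_n -> 'M[k]_n} := HB.pack cj (GRing.isLinear.Build _ _ _ _ cj cj_lin).
apply: leq_trans (_ : \dim (linfun L @: tangent x) <= _)%N; last first.
  by rewrite -[X in (_ <= X)%N](limg_ker_dim (linfun L)) leq_addl.
apply/dimvS/subvP => _ /tangentP[X uX ->].
apply/memv_imgP; exists (lie_br (invmx g *m X *m g) x).
  by apply/tangentP; exists (invmx g *m X *m g) => //; do 2![apply: upper_triM => //].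
rewrite lfunE /= cjE /lie_br mulmxBr mulmxBl; congr (_ - _); rewrite !mulmxA.
  by rewrite mulmxV // mul1mx.
by rewrite -!mulmxA mulmxV // mulmx1.
Qed.

End Conjugation.

(** * Tangent spaces along the ideal *)

Section Main.
Variables (k : closedFieldType) (n : nat) (N : {vspace 'M[k]_n}).
Hypotheses (idealN : b_ideal N) (u'N : contains_u' N) (Nu : inside_u N).
Variable w0 : bool.
Local Notation inI := (simple_in N).
Hypothesis sf : starts_false inI w0.
Local Notation tp := (@turn_pos n inI w0).
Local Notation W := (coordsp k tp).
Local Notation nf := (normal_form n inI w0).
Local Notation supported mu := (forall i, ~~ turn inI w0 i -> mu i = 0).

Lemma e_countE : e_count N = #|tp|.
Proof.
rewrite card_turn_pos; last exact: simple_in_lt.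
have -> : e_count N = match [seq i <- iota 0 n.-1 | inI i] with
    | [::] => 0
    | i :: s => count (fun d => ~~ odd d) (pairmap (fun b c => c - b) i s)
    end%N; last exact: count_even_gaps_head.
rewrite /e_count /simple_idx.
have -> // : [seq i <- iota 0 n.-1 | E k n i i.+1 \in N] = [seq i <- iota 0 n.-1 | inI i].
apply: eq_in_filter => i; rewrite mem_iota /simple_in => iN.
by have -> : (i.+1 < n)%N by lia.
Qed.

Lemma turn_pos_ideal p : tp p -> ideal_pos N p.
Proof.
case: p => a b /andP[/= /andP[Ia _] /eqP eb].
by rewrite /ideal_pos /= eb ltnSn Ia orbT.
Qed.

Lemma turn_coordsp_le : (W <= N)%VS.
Proof.
apply/subvP => Y /coordspP Y0; apply/(ideal_memP idealN u'N Nu) => a b.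
by move=> ni; apply: Y0; apply: contra ni; exact: turn_pos_ideal.
Qed.

(** A strand step of length one joins equal letters, hence occurs only at a simple position, and
    turns are simple; all other nonzero entries lie beyond the superdiagonal. *)
Lemma normal_form_mem (mu : nat -> k) : supported mu -> nf mu \in N.
Proof.
move=> mu0; apply/(ideal_memP idealN u'N Nu) => a b nab.
rewrite normal_formE; case: eqP => [en|_]; last first.
  rewrite add0r; case: eqP => [eb|_]; last by rewrite mulr0.
  rewrite mu0 ?mul0r //; apply: contra nab => ta; apply: turn_pos_ideal.
  by rewrite /turn_pos /= ta eb /=.
case/negP: nab; have gt := nxt_gt n inI w0 a; have wn := @word_nxt n inI w0 a.
rewrite en in gt wn; have {}wn := wn (ltn_ord b).
rewrite /ideal_pos /= gt /=; have [//|/= nab] := boolP (a.+1 < b)%N.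
have eb : b = a.+1 :> nat by lia.
move: wn; rewrite eb /=; case: (word _ _ a) => //=.
by case: (inI a).
Qed.

Lemma tangent_le x : x \in N -> (tangent x <= N)%VS.
Proof. by move=> xN; apply/subvP => _ /tangentP[X uX ->]; exact: idealN. Qed.

Lemma ideal_le_tangent_turn (mu : nat -> k) : supported mu -> (N <= tangent (nf mu : 'M[k]_n) + W)%VS.
Proof.
move=> mu0; rewrite {1}(ideal_coordsp idealN u'N Nu); apply: coordsp_subv => a b.
case/andP => /= ab abI; apply: E_mem => //; first exact: simple_in_lt.
by rewrite ab ltn_ord.
Qed.

(** [b, x_mu] and W both lie in [N] and meet in at most a line; the bound compares dimensions. *)
Lemma dim_tangent_normal_form (mu : nat -> k) : supported mu ->
  (\dim (tangent (nf mu : 'M[k]_n)) <= \dim N - #|tp|.-1)%N.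
Proof.
move=> mu0; have TN := tangent_le (normal_form_mem mu0).
have cap1 : (\dim (tangent (nf mu) :&: W) <= 1)%N.
  apply: leq_trans (dimvS _) (_ : \dim <[glue n mu]> <= 1)%N; last by rewrite dim_vline leq_b1.
  apply/subvP => _ /memv_capP[/tangentP[X uX ->] XW].
  have [a ->] := lie_br_turn_line (@simple_in_lt _ _ N) mu0 (turn_doubled sf) uX XW.
  by rewrite memvZ // memv_line.
have sum_le : (\dim (tangent (nf mu) + W) <= \dim N)%N.
  by apply: dimvS; rewrite subv_add TN turn_coordsp_le.
(* If W is 0 the predecessor is truncated, and the inclusion in [N] gives the bound. *)
have arith a b c d e : (b <= 1 -> a <= e -> c <= e -> a + b = c + d -> c <= e - d.-1)%N by lia.
rewrite -(dim_coordsp k tp).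
exact: arith cap1 sum_le (dimvS TN) (dimv_sum_cap _ _).
Qed.

Lemma strands_turn w : w \in W ->
  exists2 mu : nat -> k, supported mu & strands n inI w0 k + w = nf mu.
Proof.
move=> /coordspP w00; exists (fun i => entry w i i.+1) => [i ni|].
  rewrite /entry; case: insubP => // a _ ea; case: insubP => // b _ eb.
  by apply: w00; rewrite /turn_pos /= ea (negbTE ni).
congr (_ + _); apply/matrixP => a b; rewrite glueE.
have [eb|nb] := eqVneq a.+1 (b : nat); last first.
  by rewrite mulr0 w00 // /turn_pos /= eq_sym (negbTE nb) andbF.
by rewrite mulr1 eb entry_ord.
Qed.


(** The dimension of [b, x] is lower semicontinuous: a minor that is nonzero at [x] is nonzero at
    some conjugate of a normal form, where the dimension is already bounded. *)
Lemma generic_tangent_le (x : 'M[k]_n) : x \in N ->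
  (\dim (tangent x) <= \dim N - #|tp|.-1)%N.
Proof.
move=> xN; set r := (_ - _)%N; set s := \dim (tangent x).
have TN := tangent_le xN.
pose P := ideal_pos N; pose f (j : 'I_#|P|) := enum_val j.
have fP j : P (f j) by have := enum_valP j.
have fI : injective f by exact: enum_val_inj.
have fS p : P p -> exists j, f j = p.
  by move=> Pp; exists (enum_rank_in (Pp : p \in P) p); rewrite /f enum_rankK_in.
have coordK (Y : 'M[k]_n) : Y \in N -> coord_mx f (fun j => Y (f j).1 (f j).2) = Y.
  by rewrite {1}(ideal_coordsp idealN u'N Nu); exact: coord_mxK.
have /fin_all_exists2[X uX XE] (i : 'I_s) :
    exists2 X, upper_tri X & (vbasis (tangent x))`_i = lie_br X x.
  by apply/tangentP/vbasis_mem/mem_nth; rewrite size_tuple.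
pose M (y : 'M[k]_n) : 'M[k]_(#|P|, s) :=
  \matrix_(j, i) lie_br (X i) y (f j).1 (f j).2.
have M_full : row_full (M x).
  rewrite /row_full -mxrank_tr; apply: inj_row_free => v vM.
  have free_b := basis_free (vbasisP (tangent x)).
  have v0 : \sum_(i < s) v 0 i *: (vbasis (tangent x))`_i = 0.
    rewrite -(coordK (\sum_(i < s) v 0 i *: (vbasis (tangent x))`_i)); last first.
      apply: memv_suml => i _; apply: memvZ; apply: (subvP TN); apply: vbasis_mem.
      by apply: mem_nth; rewrite size_tuple.
    apply/matrixP => a b; rewrite !mxE big1 // => j _.
    move/rowP/(_ j): vM; rewrite !mxE summxE => vM; rewrite -[RHS](mul0rn _ (f j == (a, b))).
    congr (_ *+ _); rewrite -[RHS]vM; apply: eq_bigr => i _.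
    by rewrite XE !mxE.
  by apply/rowP => i; rewrite mxE; exact: (freeP free_b _ v0).
pose g := fullrankfun M_full.
pose G : 'M[{mpoly k[#|P|]}]_n := generic_mx k f.
pose C (Z : 'M[k]_n) : 'M[{mpoly k[#|P|]}]_n := map_mx (@mpolyC #|P| k) Z.
(* [D] is the minor of [M], at the generic point of [N], whose rows [g] make it nonzero at [x]. *)
pose D : {mpoly k[#|P|]} := \det (\matrix_(j, i)
  (C (X i) *m G - G *m C (X i)) (f (g j)).1 (f (g j)).2).
have DE y : y \in N ->
    D.@[fun j => y (f j).1 (f j).2] = \det (rowsub g (M y)).
  move=> yN; rewrite -det_map_mx; congr (\det _); apply/matrixP => j i.
  have CE Z : map_mx (meval (fun j => y (f j).1 (f j).2)) (C Z) = Z.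
    by apply/matrixP => a b; rewrite !mxE; exact: mevalC.
  have GE : map_mx (meval (fun j => y (f j).1 (f j).2)) G = y.
    by rewrite meval_generic_mx coordK.
  have XG : map_mx (meval (fun j => y (f j).1 (f j).2))
      (C (X i) *m G - G *m C (X i)) = lie_br (X i) y.
    by rewrite map_mxB !map_mxM CE GE.
  by rewrite [RHS]mxE [RHS]mxE -XG [LHS]mxE [in LHS]mxE [RHS]mxE.
have D0 : D != 0.
  apply/eqP => D0; have := DE x xN; rewrite D0 meval0 => /esym/eqP.
  by apply/negP; rewrite -unitfE -unitmxE; exact: fullrowsub_unit.
(* The strands alone are the normal form with [mu] zero, where [b, x_0] + W fills [N]. *)
have surj (c : 'I_#|P| -> k) : exists X w, [/\ upper_tri X, w \in W &
    forall i, (lie_br X (strands n inI w0 k) + w) (f i).1 (f i).2 = c i].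
  have cN : coord_mx f c \in N.
    by rewrite {1}(ideal_coordsp idealN u'N Nu); exact: coord_mx_mem.
  have [mu mu0 nfE] := strands_turn (mem0v W); rewrite addr0 in nfE.
  have := subvP (ideal_le_tangent_turn mu0) _ cN.
  case/memv_addP => _ /tangentP[Y uY ->] [w wW e]; exists Y, w; split=> // i.
  by rewrite nfE -e coord_mxE.
have [h [w [bh wW Dh]]] := orbit_dominant surj D0.
have [mu mu0 nfE] := strands_turn wW; rewrite nfE in Dh.
have yN := conj_ideal_mem idealN u'N Nu bh (normal_form_mem mu0).
set y := _ *m _ in yN Dh; rewrite DE // in Dh.
apply: leq_trans (dim_tangent_normal_form mu0).
apply: leq_trans (dim_tangent_conj (nf mu) bh); rewrite -/y.
pose Z := [tuple lie_br (X i) y | i < s].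
have Zfree : free Z.
  apply/freeP => v v0 i; suff: \row_i v i = 0 by move/rowP/(_ i); rewrite !mxE.
  have Mu : (rowsub g (M y))^T \in unitmx by rewrite unitmx_tr unitmxE unitfE.
  rewrite -[LHS](mulmxK Mu) [X in X *m _](_ : _ = 0) ?mul0mx //.
  apply/rowP => j; rewrite !mxE.
  move/matrixP/(_ (f (g j)).1 (f (g j)).2): v0; rewrite !mxE summxE => v0; rewrite -[RHS]v0.
  by apply: eq_bigr => l _; rewrite !mxE -tnth_nth tnth_mktuple !mxE.
have : (<<Z>> <= tangent y)%VS.
  by apply/span_subvP => _ /tnthP[i ->]; rewrite tnth_mktuple; apply/tangentP; exists (X i).
by move/dimvS; rewrite (eqP Zfree) size_tuple.
Qed.

(** These coordinates remain independent on the large orbit; among the turns only [p0] is kept. *)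
Definition pivots (p0 : 'I_n * 'I_n) : pred ('I_n * 'I_n) :=
  fun p => ideal_pos N p && ~~ (tp p && (p != p0)).

(** If there is no turn, [p0] is a dummy pair, available because [n] is at least 2. *)
Lemma exists_pivot : (2 <= n)%N -> exists p0, (exists p, tp p) -> tp p0.
Proof.
move=> n2; have [p0 tp0|no] := pickP tp; first by exists p0.
by exists (Ordinal (ltnW n2), Ordinal n2) => -[p]; rewrite no.
Qed.

Lemma card_pivots p0 : ((exists p, tp p) -> tp p0) -> #|pivots p0| = (\dim N - #|tp|.-1)%N.
Proof.
move=> tp0; rewrite {1}(ideal_coordsp idealN u'N Nu) dim_coordsp.
rewrite -(cardID [predD1 tp & p0] (ideal_pos N)).
have -> : #|[predI ideal_pos N & [predD1 tp & p0]]| = #|tp|.-1.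
  transitivity #|[predD1 tp & p0]|.
    apply: eq_card => p; have := @turn_pos_ideal p; rewrite !inE.
    rewrite -[p \in tp]/(tp p) -[p \in ideal_pos N]/(ideal_pos N p).
    by case: (tp p) (ideal_pos N p) => [] [] //= => [/(_ isT)|]; rewrite ?andbF.
  rewrite (cardD1 p0 tp); have [//|ntp] := boolP (p0 \in tp).
  rewrite add0n eq_card0 // => p; rewrite !inE; apply/negP => /andP[_ tpp].
  by case/negP: ntp; apply: tp0; exists p.
rewrite addKn; apply: eq_card => p; rewrite !inE -[p \in pivots p0]/(pivots p0 p) /pivots.
by rewrite andbC [(_ != _) && _]andbC.
Qed.

(** The glue is kept only at [p0]. Then [b, x] fills [N] up to the turns other than [p0], so
    [orbit_dominant] applies to the pivot coordinates with the zero subspace. *)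
Lemma exists_large_orbit p0 : ((exists p, tp p) -> tp p0) ->
  exists2 x, x \in N & forall (d : nat) (f : 'I_d -> 'I_n * 'I_n) (p : {mpoly k[d]}),
    injective f -> (forall i, pivots p0 (f i)) -> p != 0 ->
    exists2 y, borbit x y & p.@[fun i => y (f i).1 (f i).2] != 0.
Proof.
move=> tp0; pose mu i : k := (turn inI w0 i && (i == p0.1))%:R.
have mu0 : supported mu by move=> i /negbTE ni; rewrite /mu ni.
exists (nf mu) => [|d f p fI fP p_neq0]; first exact: normal_form_mem.
have [c|g [w [bg]]] := @orbit_dominant k n d f (nf mu) 0%VS p _ p_neq0; last first.
  by rewrite memv0 => /eqP->; rewrite addr0 => pg; exists (g *m nf mu *m invmx g) => //; exists g.
have cN : coord_mx f c \in N.
  rewrite {1}(ideal_coordsp idealN u'N Nu); apply: coord_mx_mem => i.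
  by have /andP[] := fP i.
have := subvP (ideal_le_tangent_turn mu0) _ cN.
case/memv_addP => _ /tangentP[Y uY ->] [w /coordspP wW e].
(* [A] is the idempotent of the [false] strand: it commutes with the strands, and its bracket with
   the glue is minus the glue. *)
pose A : 'M[k]_n := diag_mx (\row_i (~~ word inI w0 i)%:R).
have brA (Z : 'M[k]_n) (a b : 'I_n) :
    lie_br A Z a b = ((~~ word inI w0 a)%:R - (~~ word inI w0 b)%:R) * Z a b.
  by rewrite /lie_br mul_diag_mx mul_mx_diag !mxE mulrBl [Z a b * _]mulrC.
have nfA (a b : 'I_n) : lie_br A (nf mu) a b = - (mu a * (a.+1 == b :> nat)%:R).
  have nxt_word : nxt n inI w0 a = b -> word inI w0 b = word inI w0 a.
    by move=> e1; rewrite -(@word_nxt n inI w0 a) e1.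
  rewrite brA normal_formE; have [/andP[Ia wa]|ta] := boolP (turn inI w0 a); last first.
    rewrite mu0 // !mul0r oppr0 addr0.
    by case: eqP => [/nxt_word->|_]; rewrite ?mulr0 // subrr mul0r.
  have wa1 := word_true_next wa; have [eb|nb] := eqVneq a.+1 (b : nat).
    rewrite -eb wa1 wa sub0r mulr1 mulN1r; case: eqP => [e1|_]; last by rewrite add0r.
    by move: wa; rewrite -nxt_word -?eb ?wa1 // -e1.
  rewrite mulr0 addr0 oppr0.
  by case: eqP => [/nxt_word->|_]; rewrite ?mulr0 // subrr mul0r.
(* The multiple of [A] cancels the component of [w] at [p0]; its other components are not at
   pivots. *)
exists (Y - w p0.1 p0.2 *: A), 0; split; [|exact: mem0v|move=> i].
  apply: upper_triD => //; rewrite -scaleNr; apply: upper_triZ => r s sr; rewrite mxE -val_eqE.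
  by rewrite gtn_eqF ?mulr0n.
have -> : lie_br (Y - w p0.1 p0.2 *: A) (nf mu) =
    lie_br Y (nf mu) - w p0.1 p0.2 *: lie_br A (nf mu).
  rewrite /lie_br mulmxBl mulmxBr -scalemxAl -scalemxAr scalerBr !opprB.
  by rewrite [LHS]addrACA [RHS]addrACA; congr (_ + _); rewrite addrC.
have -> : lie_br Y (nf mu) = coord_mx f c - w by rewrite e addrK.
have ent (U V Z : 'M[k]_n) s a b : (U - V - s *: Z + 0) a b = U a b - V a b - s * Z a b.
  by rewrite addr0 !mxE.
rewrite ent coord_mxE // nfA; case/andP: (fP i) => _; rewrite negb_and negbK.
have [tpi /= /eqP fi|ntp _] := boolP (tp (f i)); last first.
  have w_fi : w (f i).1 (f i).2 = 0 by apply: wW; rewrite -surjective_pairing.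
  rewrite w_fi subr0; suff -> : mu (f i).1 * ((f i).1.+1 == (f i).2 :> nat)%:R = 0.
    by rewrite oppr0 mulr0 subr0.
  have [ti|ti] := boolP (turn inI w0 (f i).1); last by rewrite mu0 // mul0r.
  have /negbTE-> : (f i).1.+1 != (f i).2 :> nat.
    by apply: contra ntp; rewrite eq_sym /turn_pos ti.
  by rewrite mulr0.
have /andP[t1 /eqP t2] := tpi; rewrite fi in t1 t2 *.
by rewrite /mu t1 t2 !eqxx mulr1 mulrN mulr1 opprK subrK.
Qed.

End Main.

Theorem theorem1p1 (k : closedFieldType) (n : nat) (N : {vspace 'M[k]_n}) :
  (2 <= n)%N -> b_ideal N -> contains_u' N -> inside_u N ->
  (dense_orbit N <-> (e_count N <= 1)%N) /\
  ((exists x, x \in N /\ dim_ge (borbit x) (\dim N - (e_count N).-1)) /\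
   (forall x, x \in N -> ~ dim_ge (borbit x) (\dim N - (e_count N).-1).+1)).
Proof.
move=> n2 idealN u'N Nu.
have [w0 sf] : exists w0, starts_false (simple_in N) w0.
  by apply: (@exists_starts_false _ n) => i /simple_in_lt/ltnW.
have [p0 tp0] := @exists_pivot k n N w0 n2.
have [x xN large] := exists_large_orbit idealN u'N Nu tp0.
have cardP := card_pivots idealN u'N Nu tp0.
have eE := e_countE sf; rewrite -eE in cardP.
have equation y d (f : 'I_d -> 'I_n * 'I_n) : y \in N ->
    (\dim N - (e_count N).-1 < d)%N -> exists2 p : {mpoly k[d]}, p != 0 &
    forall z, borbit y z -> p.@[fun i => z (f i).1 (f i).2] = 0.
  move=> yN lt; apply: orbit_equation; apply: leq_ltn_trans lt.
  by rewrite eE; exact: (generic_tangent_le idealN u'N Nu sf yN).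
split; last split.
- split=> [[y [yN dense]]|e1].
    rewrite leqNgt; apply/negP => e2.
    (* This is one more coordinate than the orbit dimension allows. As e is at least 2, [N] has that
       many coordinates, so an equation of the orbit in them does not vanish on [N]. *)
    pose d := (\dim N - (e_count N).-1).+1.
    have dimN : \dim N = #|ideal_pos N|.
      by rewrite {1}(ideal_coordsp idealN u'N Nu) dim_coordsp.
    have dN : (d <= #|ideal_pos N|)%N.
      have : (#|@turn_pos n (simple_in N) w0| <= #|ideal_pos N|)%N.
        by apply: subset_leq_card; apply/subsetP => p; exact: turn_pos_ideal.
      by rewrite -eE -dimN /d; move: (\dim N) (e_count N) e2 => a b; lia.
    pose f (i : 'I_d) := enum_val (widen_ord dN i).
    have fI : injective f by move=> i j /enum_val_inj/(congr1 val) /= /val_inj.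
    have [p p_neq0 pz] := equation y d f yN (ltnSn _).
    have [v pv] := mpoly_nonvanishing p_neq0.
    pose q := p \mPo [tuple 'X_(mxvec_index (f i).1 (f i).2) : {mpoly k[n * n]} | i < d].
    have qE z : q.@[coords z] = p.@[fun i => z (f i).1 (f i).2].
      rewrite comp_mpoly_meval; apply: meval_eq => i.
      by rewrite tnth_mktuple mevalXU /coords mxvecE.
    have cN : coord_mx f v \in N.
      rewrite {1}(ideal_coordsp idealN u'N Nu); apply: coord_mx_mem => i.
      exact: (enum_valP (widen_ord dN i)).
    case/eqP: pv; have := dense q _ _ cN; rewrite qE => <- => [|z yz].
      by apply: meval_eq => i; rewrite coord_mxE.
    by rewrite qE pz.
  (* If e is at most 1, every position of the ideal is a pivot, so [p] restricts on [N] to a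
     polynomial in the pivot coordinates, which are independent on the orbit of [x]. *)
  exists x; split=> // p pz y yN; apply/eqP; apply: contraT => py.
  pose P := pivots N w0 p0; pose f (i : 'I_#|P|) := enum_val i.
  have fP i : P (f i) by have := enum_valP i.
  have fI : injective f by exact: enum_val_inj.
  have fS u : P u -> exists j, f j = u.
    by move=> Pu; exists (enum_rank_in (Pu : u \in P) u); rewrite /f enum_rankK_in.
  have coordK z : z \in N -> coord_mx f (fun i => z (f i).1 (f i).2) = z.
    move=> zN; apply: (coord_mxK fI fS); apply/coordspP => a b nP.
    move/(ideal_memP idealN u'N Nu): zN; apply; apply: contra nP => abN.
    rewrite /P /pivots abN /=; apply/negP => /andP[tab /negP]; apply; apply/eqP.
    rewrite eE in e1; have /card_le1_eqP := e1; apply; rewrite ?unfold_in //.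
    by apply: tp0; exists (a, b).
  pose q := p \mPo [tuple mxvec (generic_mx k f) 0 i | i < n * n].
  have qE z : z \in N -> q.@[fun i => z (f i).1 (f i).2] = p.@[coords z].
    move=> zN; rewrite comp_mpoly_meval; apply: meval_eq => i.
    rewrite tnth_mktuple -[in RHS](coordK z zN) /coords -meval_generic_mx -map_mxvec.
    by rewrite [RHS]mxE.
  have q_neq0 : q != 0 by apply: contraNneq py => q0; rewrite -qE // q0 meval0.
  have [z xz] := large _ f q fI fP q_neq0; rewrite qE ?pz ?eqxx //.
  by have [g [bg ->]] := xz; exact: conj_ideal_mem.
- exists x; split=> //; rewrite -cardP.
  exists (fun i => enum_val i) => p p_neq0.
  have [i|y xy py] := large _ _ p enum_val_inj _ p_neq0.
    exact: (enum_valP i).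
  by exists y.
- move=> y yN [f indep]; have [p p_neq0 pz] := equation y _ f yN (ltnSn _).
  by have [z [yz]] := indep p p_neq0; rewrite pz ?eqxx.
Qed.
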